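(* Let $\{Y(u,n):u\in\mathcal U,\ n\in\mathbb N\}$ be a family of independent Hermitian random matrices, $Y(u,n)$ being of size $n\times n$, whose asymptotic joint distribution under $\tau(n)$ agrees with that of the family $\{\gamma(u):u\in\mathcal U\}$ under $\Psi=\sum_{q}d_q\Psi_q$ and which is asymptotically free from $\{D_1,\dots,D_r\}$ (under $\tau(n)$). If $\|Y(u,n)\|\le C$ for all $n,u$ and some constant $C$, then $$\lim_{n\to\infty}\tau(n)\big(T_{p_1,q_1}(u_1,n)\cdots T_{p_m,q_m}(u_m,n)\big)=\Psi\big(\widehat\gamma_{p_1,q_1}(u_1)\cdots\widehat\gamma_{p_m,q_m}(u_m)\big)$$ for any $m\in\mathbb N$, $(p_1,q_1),\dots,(p_m,q_m)\in[r]\times[r]$ and $u_1,\dots,u_m\in\mathcal U$.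
   Context: Random matrices. Fix $r\in\mathbb N$, $[r]=\{1,\dots,r\}$, and a finite index set $\mathcal U$. For each $n$ let $[n]=\{1,\dots,n\}$ be partitioned into disjoint nonempty intervals $N_1,\dots,N_r$ (depending on $n$), $n_q=|N_q|$, and assume $\lim_{n\to\infty}n_q/n=d_q\ge 0$ for each $q$ (so $\sum_q d_q=1$; some $d_q$ may be $0$). $D_q$ is the $n\times n$ diagonal matrix with $(D_q)_{j,j}=1$ if $j\in N_q$ and all other entries $0$. Random matrices have entries in $L=\bigcap_{1\le p<\infty}L^p$ of a probability space; $\mathbb E$ is expectation, $\|\cdot\|$ the operator norm. $\tau(n)=\mathbb E\otimes\mathrm{tr}(n)$, where $\mathrm{tr}(n)(A)=\frac1n\sum_{j=1}^n A_{j,j}$. The symmetric blocks are $T_{q,q}(u,n)=D_qY(u,n)D_q$ and $T_{p,q}(u,n)=D_pY(u,n)D_q+D_qY(u,n)D_p$ for $p\ne q$. ''Asymptotic joint distribution agrees'' means that all mixed moments of the $Y(u,n)$ under $\tau(n)$ converge to the corresponding mixed moments of the $\gamma(u)$ under $\Psi$; ''asymptotically free from $\{D_1,\dots,D_r\}$'' means that the joint moments of the two families under $\tau(n)$ converge to those of two families that are free. Operators. $\mathcal M$ is the Hilbert space with orthonormal basis consisting of vacuum vectors $\Omega_1,\dots,\Omega_r$ and all simple tensors $e_{p_1,p_2}(u_1)\otimes e_{p_2,p_3}(u_2)\otimes\cdots\otimes e_{p_m,q}(u_m)$ with $m\ge1$, $p_1,\dots,p_m,q\in[r]$, $u_1,\dots,u_m\in\mathcal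 U$. Put $\Psi_q(a)=\langle a\Omega_q,\Omega_q\rangle$ and $\Psi=\sum_q d_q\Psi_q$. The matricially free creation operators $\wp_{p,q}(u)$ with covariance $d_p$ are the bounded operators given by $\wp_{p,q}(u)\Omega_q=\sqrt{d_p}\,e_{p,q}(u)$, $\wp_{p,q}(u)(e_{q,s}(t)\otimes w)=\sqrt{d_p}\,e_{p,q}(u)\otimes e_{q,s}(t)\otimes w$ for every basis vector $e_{q,s}(t)\otimes w$, and zero on all other basis vectors. Put $\wp(u)=\sum_{p,q=1}^r\wp_{p,q}(u)$. $P_q$ is the orthogonal projection onto the closed span of $\Omega_q$ and all simple tensors whose first factor is of the form $e_{q,s}(t)$. Let $(r_k(u))_{k\ge1}$, $u\in\mathcal U$, be sequences of real numbers (the free cumulants of probability measures $\mu(u)$ on $\mathbb R$). The canonical noncommutative random variables are $\gamma(u)=\wp(u)^*+\sum_{k=0}^\infty r_{k+1}(u)\wp(u)^k$. For $p\neq q$, $\widehat\gamma_{p,q}(u)=P_p\gamma(u)P_q+P_q\gamma(u)P_p$, and $\widehat\gamma_{q,q}(u)=P_q\gamma(u)P_q$. If the series do not define bounded operators, a mixed moment of order $m$ is understood as the one obtained by truncating every series at some $k\le N$ with $N\ge m$ (the value does not depend on such $N$). *)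

(* Defs.v *)
From HB Require Import structures.
From mathcomp Require Import all_boot all_order all_algebra.
From mathcomp Require Import all_classical all_reals all_analysis.
Import Order.TTheory GRing.Theory Num.Theory numFieldNormedType.Exports.
From mathcomp.real_closed Require Import complex.
From mathcomp Require Import lra ring.
Import ComplexField.Normc.

Set Implicit Arguments.
Unset Strict Implicit.
Unset Printing Implicit Defensive.

Local Open Scope classical_set_scope.
Local Open Scope ring_scope.
Local Open Scope complex_scope.

Section Sums.
Variables (R : realType) (I : choiceType).
Implicit Types (f g h : I -> R).

Definition rsummable h : Prop := summable setT (EFin \o h).

(* The value of the sum when [rsummable h] *)
Definition rsum h : R :=
  fine (\esum_(i in setT) (EFin \o h)^\+%E i
        - \esum_(i in setT) (EFin \o h)^\-%E i)%E.

Lemma le_rsummable f g : (forall i, `|f i| <= g i) -> rsummable g ->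
  rsummable f.
Proof.
move=> fg; apply: le_lt_trans; apply: le_esum => i _ /=.
by rewrite lee_fin (le_trans (fg i))// ler_norm.
Qed.

Lemma eq_rsummable f g : f =1 g -> rsummable g -> rsummable f.
Proof. by move=> /funext ->. Qed.

Lemma rsummable0 : rsummable (fun=> 0).
Proof. by rewrite /rsummable /summable esum1// => i _ /=; rewrite normr0. Qed.

Lemma rsummableD f g : rsummable f -> rsummable g ->
  rsummable (fun i => f i + g i).
Proof. by move=> sf sg; exact: (summableD sf sg). Qed.

Lemma rsummableZ (K : R) f : rsummable f -> rsummable (fun i => K * f i).
Proof.
move=> sf.
have sn : rsummable (fun i => `|f i| *+ Num.bound `|K|).
  elim: (Num.bound `|K|) => [|n IH]; first exact: rsummable0.
  apply: (@eq_rsummable _ (fun i => `|f i| + `|f i| *+ n)).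
    by move=> i; rewrite mulrS.
  apply: rsummableD IH; move: sf; rewrite /rsummable /summable.
  by under eq_esum => i _ do rewrite /= -[X in X%:E]normr_id.
apply: le_rsummable sn => i; rewrite normrM -[leRHS]mulr_natl.
by rewrite ler_wpM2r// ltW// archi_boundP.
Qed.

Lemma rsum_pos f : (forall i, 0 <= f i) ->
  rsum f = fine (\esum_(i in setT) (f i)%:E).
Proof.
move=> f0; rewrite /rsum [X in (_ - X)%E]esum1 ?sube0.
  congr fine; apply: eq_esum => i _.
  by rewrite /= funeposE/= -EFin_max; congr EFin; apply/max_idPl.
by move=> i _; rewrite /= funenegE/= -EFin_max; congr EFin;
  apply/max_idPr; rewrite oppr_le0.
Qed.

Lemma rsumB f g : rsummable f -> rsummable g ->
  (forall i, 0 <= f i) -> (forall i, 0 <= g i) ->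
  rsum (fun i => f i - g i) = rsum f - rsum g.
Proof.
move=> sf sg f0 g0.
have H := @esumB R I setT _ _ sf sg
  (fun i _ => (f0 i : (0 <= (f i)%:E)%E)) (fun i _ => (g0 i : (0 <= (g i)%:E)%E)).
rewrite [LHS](_ : _ = fine (\esum_(i in setT) (f i)%:E
   - \esum_(i in setT) (g i)%:E)%E); last by rewrite -H.
have fin k : rsummable k -> (forall i, 0 <= k i) ->
  (\esum_(i in setT) (k i)%:E)%E \is a fin_num.
  rewrite /rsummable => sk k0; move: sk; rewrite summableE.
  by under eq_esum => i _ do rewrite /= ger0_norm//.
by rewrite fineB ?fin// !rsum_pos.
Qed.

Lemma rsumD f g : rsummable f -> rsummable g ->
  rsum (fun i => f i + g i) = rsum f + rsum g.
Proof.
move=> sf sg.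
pose p h i := Num.max (h i) 0; pose m h i := Num.max (- h i) 0.
have pm h i : h i = p h i - m h i.
  by rewrite /p /m; case: (lerP (h i) 0) => ?; case: (lerP (- h i) 0) => ?; lra.
have p0 h i : 0 <= p h i by rewrite /p le_max lexx orbT.
have m0 h i : 0 <= m h i by rewrite /m le_max lexx orbT.
have ps h : rsummable h -> rsummable (p h).
  move=> sh; apply: (@le_rsummable _ (fun i => `|h i|)).
    by move=> i; rewrite ger0_norm// /p ge_max ler_norm normr_ge0.
  by apply: le_lt_trans sh; apply: le_esum => i _ /=; rewrite normr_id.
have ms h : rsummable h -> rsummable (m h).
  move=> sh; apply: (@le_rsummable _ (fun i => `|h i|)).
    by move=> i; rewrite ger0_norm// /m ge_max -normrN ler_norm normr_ge0.
  by apply: le_lt_trans sh; apply: le_esum => i _ /=; rewrite normr_id.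
have split h : rsummable h -> rsum h = rsum (p h) - rsum (m h).
  by move=> sh; rewrite -rsumB; [congr rsum; exact/funext/pm|exact: ps|exact: ms| |].
have posD k l : rsummable k -> rsummable l -> (forall i, 0 <= k i) ->
    (forall i, 0 <= l i) -> rsum (fun i => k i + l i) = rsum k + rsum l.
  move=> sk sl k0 l0; rewrite !rsum_pos//; last by move=> i; rewrite addr_ge0.
  under eq_esum => i _ do rewrite EFinD.
  rewrite esumD//; [|by move=> i _; rewrite lee_fin..].
  rewrite fineD//.
    by move: sk; rewrite /rsummable summableE; under eq_esum => i _ do rewrite /= ger0_norm//.
  by move: sl; rewrite /rsummable summableE; under eq_esum => i _ do rewrite /= ger0_norm//.
rewrite (_ : (fun i => f i + g i) =
  (fun i => (p f i + p g i) - (m f i + m g i))); last first.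
  by apply/funext => i; rewrite {1}(pm f) {1}(pm g); ring.
rewrite rsumB.
- by rewrite (posD (p f)) ?(posD (m f)) ?(split f) ?(split g)//;
    [ring|exact: ms|exact: ms|exact: ps|exact: ps].
- by apply: rsummableD; exact: ps.
- by apply: rsummableD; exact: ms.
- by move=> i; rewrite addr_ge0.
- by move=> i; rewrite addr_ge0.
Qed.

End Sums.

Section Reindex.
Variables (R : realType) (I : choiceType) (A : pred I) (c : I -> I).
Hypothesis c_inj : injective c.

Lemma esum_reindex (h : I -> \bar R) : (forall j, ~ (c @` [set i | A i]) j -> h j = 0%E) ->
  \esum_(i in setT) h i = \esum_(i in setT) (if A i then h (c i) else 0%E).
Proof.
move=> h0.
rewrite [RHS](_ : _ = \esum_(i in [set i | A i]) h (c i)); last first.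
  rewrite [RHS]esum_mkcond; apply: eq_esum => i _; congr (if _ then _ else _).
  by apply/idP/idP; rewrite inE.
rewrite -(@esum_image _ _ _ [set i | A i] c)//; last first.
  by move=> x y _ _ /c_inj.
rewrite [RHS]esum_mkcond; apply: eq_esum => j _.
by case: ifPn => // /negP; rewrite inE => /h0.
Qed.

Lemma rsummable_reindex (h : I -> R) : (forall j, ~ (c @` [set i | A i]) j -> h j = 0) ->
  rsummable h <-> rsummable (fun i => if A i then h (c i) else 0).
Proof.
move=> h0; rewrite /rsummable /summable esum_reindex; last first.
  by move=> j /h0 /= ->; rewrite normr0.
have -> : \esum_(i in setT) (if A i then `|(EFin \o h) (c i)| else 0)%E =
  \esum_(i in setT)
    `|(EFin \o (fun i => if A i then h (c i) else 0%R)) i|%E.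
  by apply: eq_esum => i _ /=; case: ifP => //; rewrite normr0.
by [].
Qed.

Lemma rsum_reindex (h : I -> R) : (forall j, ~ (c @` [set i | A i]) j -> h j = 0) ->
  rsum h = rsum (fun i => if A i then h (c i) else 0).
Proof.
move=> h0; rewrite /rsum; congr (fine (_ - _)).
- rewrite esum_reindex.
    apply: eq_esum => i _; rewrite !funeposE/=; case: ifP => //.
    by rewrite maxxx.
  by move=> j /h0; rewrite funeposE/= => ->; rewrite maxxx.
- rewrite esum_reindex.
    apply: eq_esum => i _; rewrite !funenegE/=; case: ifP => //.
    by rewrite oppr0 maxxx.
  by move=> j /h0; rewrite funenegE/= => ->; rewrite oppr0 maxxx.
Qed.

End Reindex.

Section HilbertSpace.
Variables (R : realType) (I : choiceType).
Local Notation C := R[i].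

Definition sq_summable (f : I -> C) : Prop :=
  rsummable (fun i => normc (f i) ^+ 2).

Definition l2_pred : {pred I -> C} := fun f => `[< sq_summable f >].

Lemma normc_sqr (z : C) : normc z ^+ 2 = complex.Re z ^+ 2 + complex.Im z ^+ 2.
Proof. by case: z => a b /=; rewrite sqr_sqrtr// addr_ge0// sqr_ge0. Qed.

Lemma le_sq_summable (f g : I -> C) (K : R) :
  (forall i, normc (f i) ^+ 2 <= K * normc (g i) ^+ 2) ->
  sq_summable g -> sq_summable f.
Proof.
move=> fg /(rsummableZ K); apply: le_rsummable => i.
by rewrite ger0_norm ?sqr_ge0.
Qed.

Lemma normc2_eq0 (z : C) : z = 0 -> normc z ^+ 2 = 0.
Proof. by move=> ->; rewrite normc_sqr/= expr0n addr0. Qed.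

Lemma sq_summable0 : sq_summable (fun=> 0).
Proof.
apply: eq_rsummable (rsummable0 _ _) => i.
by rewrite normc0 expr0n.
Qed.

Lemma sq_summableZ (a : C) (f : I -> C) :
  sq_summable f -> sq_summable (fun i => a * f i).
Proof.
by apply: (le_sq_summable (K := normc a ^+ 2)) => i; rewrite normcM exprMn.
Qed.

Lemma sq_summableD (f g : I -> C) : sq_summable f -> sq_summable g ->
  sq_summable (fun i => f i + g i).
Proof.
move=> sf sg; have := rsummableD (rsummableZ 2 sf) (rsummableZ 2 sg).
apply: le_rsummable => i; rewrite ger0_norm ?sqr_ge0// !normc_sqr.
case: (f i) (g i) => [a b] [x y] /=.
by have := sqr_ge0 (a - x); have := sqr_ge0 (b - y); nra.
Qed.

Lemma l2_submod_closed : submod_closed l2_pred.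
Proof.
split=> [|a f g]; rewrite /in_mem /= /l2_pred.
  by apply/asboolP; exact: sq_summable0.
move=> /asboolP sf /asboolP sg; apply/asboolP.
exact: (sq_summableD (sq_summableZ a sf) sg).
Qed.

HB.instance Definition _ := GRing.isSubmodClosed.Build C (I -> C) l2_pred
  l2_submod_closed.

Record l2 : Type := L2 { l2_fun :> I -> C; l2_funP : l2_fun \in l2_pred }.

HB.instance Definition _ := [isSub for l2_fun].
HB.instance Definition _ := [Choice of l2 by <:].
HB.instance Definition _ := [SubChoice_isSubLmodule of l2 by <:].

Lemma l2P (f : l2) : sq_summable f.
Proof. by apply/asboolP; exact: (l2_funP f). Qed.

Definition mkl2 (f : I -> C) (sf : sq_summable f) : l2 := L2 (asboolT sf).

Lemma l2_ext (f g : l2) : (forall i, f i = g i) -> f = g.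
Proof. by move=> fg; apply/val_inj/funext. Qed.

Lemma l2_addE (f g : l2) i : (f + g) i = f i + g i. Proof. by []. Qed.
Lemma l2_scaleE a (f : l2) i : (a *: f) i = a * f i. Proof. by []. Qed.
Lemma l2_0E i : (0 : l2) i = 0. Proof. by []. Qed.
Lemma l2_sumE (J : Type) (s : seq J) (P : pred J) (F : J -> l2) i :
  (\sum_(j <- s | P j) F j) i = \sum_(j <- s | P j) F j i.
Proof. by elim/big_ind2 : _ => // f a g b <- <-. Qed.

Definition csum (h : I -> C) : C :=
  rsum (fun i => complex.Re (h i)) +i* rsum (fun i => complex.Im (h i)).

Definition inner (f g : l2) : C := csum (fun i => f i * conjc (g i)).

Lemma sq_summable_ket (j : I) : sq_summable (fun i => (i == j)%:R).
Proof.
rewrite /sq_summable /rsummable /summable.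
rewrite [X in (X < _)%E](_ : _ =
    \esum_(i in setT) (if i \in [set j] then 1%E else 0%E : \bar R)); last first.
  apply: eq_esum => i _ /=; rewrite classical_sets.in_set1.
  by case: eqP => _; rewrite ?normc1 ?normc0 ?expr1n ?expr0n/= ?normr1 ?normr0.
by rewrite -esum_mkcond esum_set1// ltry.
Qed.

(* [l2] is the Hilbert space with orthonormal basis [(ket j)_j] *)
Definition ket (j : I) : l2 := mkl2 (sq_summable_ket j).

(* For a bounded operator [A] this is the Hilbert-space adjoint; the default
   value is taken only if there is no adjoint *)
Definition adjoint (A : l2 -> l2) : l2 -> l2 :=
  xget (fun=> 0) [set B | forall f g, inner (A f) g = inner f (B g)].

Lemma rsum_supp1 (h : I -> R) j : (forall i, i != j -> h i = 0) -> rsum h = h j.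
Proof.
move=> h0; rewrite /rsum.
have S (k : I -> \bar R) : (forall i, i != j -> k i = 0%E) -> (0 <= k j)%E ->
    \esum_(i in setT) k i = k j.
  move=> k0 kj; rewrite -[RHS](@esum_set1 R I)// [RHS]esum_mkcond.
  by apply: eq_esum => i _; rewrite classical_sets.in_set1; case: eqP => // /eqP /k0.
rewrite !S//.
- rewrite funeposE funenegE/= -!EFin_max /=.
  by case: (lerP (h j) 0) => ?; case: (lerP (- h j) 0) => ?; lra.
- by move=> i /h0; rewrite funenegE /= => ->; rewrite oppr0 maxxx.
- by move=> i /h0; rewrite funeposE /= => ->; rewrite maxxx.
Qed.

Lemma ketE j i : ket j i = (i == j)%:R. Proof. by []. Qed.

Lemma csum_supp1 (h : I -> C) j : (forall i, i != j -> h i = 0) ->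
  csum h = h j.
Proof.
move=> h0; rewrite /csum !(@rsum_supp1 _ j); first by case: (h j).
  by move=> i /h0 ->.
by move=> i /h0 ->.
Qed.

Lemma conj_ket j i : conjc (ket j i) = (i == j)%:R.
Proof. by rewrite ketE; case: eqP => _; [exact: conjc1|exact: conjc0]. Qed.

Lemma inner_ketr (f : l2) j : inner f (ket j) = f j.
Proof.
rewrite /inner (@csum_supp1 _ j) => [|i /negPf ij].
  by rewrite conj_ket eqxx mulr1.
by rewrite conj_ket ij mulr0.
Qed.

Lemma inner_ketl (f : l2) j : inner (ket j) f = conjc (f j).
Proof.
rewrite /inner (@csum_supp1 _ j) => [|i /negPf ij].
  by rewrite ketE eqxx mul1r.
by rewrite ketE ij mul0r.
Qed.

Lemma adjoint_eq (A B : l2 -> l2) :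
  (forall f g, inner (A f) g = inner f (B g)) -> adjoint A = B.
Proof.
move=> AB; rewrite /adjoint; case: xgetP => [B' _ /= AB'|/(_ B)]; last by [].
apply/funext => g; apply: l2_ext => j; apply: (can_inj (@conjcK R)).
by rewrite -!inner_ketl -AB -AB'.
Qed.

Lemma summable_inner (f g : l2) :
  rsummable (fun i => complex.Re (f i * conjc (g i))) /\
  rsummable (fun i => complex.Im (f i * conjc (g i))).
Proof.
split; have := rsummableD (l2P f) (l2P g);
  apply: le_rsummable => i; rewrite !normc_sqr;
  case: (f i) (g i) => [a b] [x y] /=; rewrite ler_norml;
  have := sqr_ge0 (a - x); have := sqr_ge0 (b - y);
  have := sqr_ge0 (a - y); have := sqr_ge0 (b - x);
  have := sqr_ge0 (a + x); have := sqr_ge0 (b + y);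
  have := sqr_ge0 (a + y); have := sqr_ge0 (b + x);
  move=> *; apply/andP; split; nra.
Qed.

Lemma innerDl (f1 f2 g : l2) : inner (f1 + f2) g = inner f1 g + inner f2 g.
Proof.
have [s1 t1] := summable_inner f1 g; have [s2 t2] := summable_inner f2 g.
rewrite /inner /csum.
rewrite -[RHS]/((_ + _) +i* (_ + _)) -!rsumD//.
by apply: (congr2 (@Complex R)); congr rsum; apply/funext => i; rewrite l2_addE mulrDl;
  case: (f1 i * _) (f2 i * _) => [? ?] [].
Qed.

Lemma innerDr (f g1 g2 : l2) : inner f (g1 + g2) = inner f g1 + inner f g2.
Proof.
have [s1 t1] := summable_inner f g1; have [s2 t2] := summable_inner f g2.
rewrite /inner /csum.
rewrite -[RHS]/((_ + _) +i* (_ + _)) -!rsumD//.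
by apply: (congr2 (@Complex R)); congr rsum; apply/funext => i;
  rewrite l2_addE rmorphD mulrDr; case: (f i * _) (f i * _) => [? ?] [].
Qed.

Lemma inner0l g : inner 0 g = 0.
Proof. by apply: (addrI (inner 0 g)); rewrite -innerDl !addr0. Qed.

Lemma inner0r g : inner g 0 = 0.
Proof. by apply: (addrI (inner g 0)); rewrite -innerDr !addr0. Qed.

End HilbertSpace.

Section Fock.
Variables (R : realType) (r : nat) (U : finType).
Variables (d : 'I_r -> R) (kappa : U -> nat -> R).
Local Notation C := R[i].

(* [([::], q)] is the vacuum vector [Omega_q], and
   [([:: (p_1, u_1); ...; (p_m, u_m)], q)] is the simple tensor
   [e_{p_1,p_2}(u_1) (x) ... (x) e_{p_m,q}(u_m)]: the second index of each
   factor is the first index of the next one, so it is not repeated *)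
Definition word : Type := (seq ('I_r * U) * 'I_r)%type.
HB.instance Definition _ := Choice.on word.

Definition vacuum (q : 'I_r) : word := ([::], q).

(* the index [q] such that [w] is [Omega_q] or starts with some [e_{q,s}(t)] *)
Definition start (w : word) : 'I_r :=
  if w.1 is x :: _ then x.1 else w.2.

Definition push (p : 'I_r) (u : U) (w : word) : word := ((p, u) :: w.1, w.2).

Local Notation M := (l2 R word).

Definition creation_fun (p q : 'I_r) (u : U) (f : word -> C) : word -> C :=
  fun w => if w.1 is x :: s then
             if (x == (p, u)) && (start (s, w.2) == q)
             then (Num.sqrt (d p))%:C * f (s, w.2) else 0
           else 0.

Definition annihilation_fun (p q : 'I_r) (u : U) (f : word -> C) : word -> C :=
  fun w => if start w == q then (Num.sqrt (d p))%:C * f (push p u w) else 0.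

Definition proj_fun (q : 'I_r) (f : word -> C) : word -> C :=
  fun w => if start w == q then f w else 0.

Lemma push_inj p u : injective (push p u).
Proof. by move=> [s q] [t q'] [-> ->]. Qed.

Lemma creation_fun_supp p q u f w :
  ~ (push p u @` [set w | start w == q]) w -> creation_fun p q u f w = 0.
Proof.
case: w => [[//|x s] t] h; rewrite /creation_fun /=.
by case: ifP => // /andP[/eqP xE sq]; case: h; exists (s, t); rewrite //= xE.
Qed.

Lemma creation_fun_push p q u f w :
  creation_fun p q u f (push p u w) =
    if start w == q then (Num.sqrt (d p))%:C * f w else 0.
Proof. by case: w => s t; rewrite /creation_fun /= eqxx. Qed.

Lemma sq_summable_if (P : pred word) (a : C) (f g : word -> C) :
  (forall w, g w = if P w then a * f w else 0) ->
  sq_summable f -> sq_summable g.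
Proof.
move=> gE; apply: (le_sq_summable (K := normc a ^+ 2)) => w; rewrite gE.
case: ifP => _; first by rewrite normcM exprMn.
by rewrite [normc 0 ^+ 2]normc2_eq0// mulr_ge0 ?sqr_ge0.
Qed.

Lemma creation_subproof p q u (f : M) : sq_summable (creation_fun p q u f).
Proof.
apply/(rsummable_reindex (A := fun w => start w == q) (@push_inj p u)).
  by move=> w /creation_fun_supp ->; rewrite normc2_eq0//.
apply: eq_rsummable (sq_summable_if (P := fun w => start w == q)
  (a := (Num.sqrt (d p))%:C) (fun w => erefl) (l2P f)) => w.
rewrite creation_fun_push.
by case: (start w == q) => //; rewrite normc2_eq0.
Qed.

Lemma annihilation_subproof p q u (f : M) :
  sq_summable (annihilation_fun p q u f).
Proof.
pose P (w : word) := if w.1 is x :: s then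
  (x == (p, u)) && (start (s, w.2) == q) else false.
have := sq_summable_if (P := P) (a := (Num.sqrt (d p))%:C)
  (fun w => erefl) (l2P f).
move/(rsummable_reindex (A := fun w => start w == q) (@push_inj p u)) => H.
apply: eq_rsummable (H _) => [[s t]|w Pw].
  rewrite /annihilation_fun /P /= eqxx /=.
  by case: (_ == q) => //; rewrite normc2_eq0.
rewrite ifN ?normc2_eq0//; apply: contra_notN Pw.
case: w => [[//|x s] t] /=; rewrite /P /= => /andP[/eqP xE sq].
by exists (s, t); rewrite //= xE.
Qed.

Lemma proj_subproof q (f : M) : sq_summable (proj_fun q f).
Proof.
by apply: (sq_summable_if (P := fun w => start w == q) (a := 1) _ (l2P f)) => w;
  rewrite mul1r.
Qed.

(* The bounded operator that maps a basis vector [ket w] to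
   [sqrt (d_p) e_{p,q}(u) (x) ket w] if [w] starts with [q] and to [0] otherwise;
   see [creation_ket] *)
Definition creation p q u (f : M) : M := mkl2 (creation_subproof p q u f).

Definition annihilation p q u (f : M) : M :=
  mkl2 (annihilation_subproof p q u f).

(* The orthogonal projection onto the closed span of the [ket w] with
   [start w = q]; see [proj_ket], [proj_idem] and [proj_selfadj] *)
Definition proj q (f : M) : M := mkl2 (proj_subproof q f).

Definition wp u (f : M) : M := \sum_p \sum_q creation p q u f.

(* [gamma N u] is the canonical variable [gamma(u)] with its series truncated
   at [k <= N]; [kappa u k] is the cumulant [r_k(u)], used for [k >= 1] only *)
Definition gamma N u (f : M) : M :=
  adjoint (wp u) f + \sum_(k < N.+1) (kappa u k.+1)%:C *: iter k (wp u) f.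

Definition hat_gamma N (p q : 'I_r) u (f : M) : M :=
  if p == q then proj q (gamma N u (proj q f))
  else proj p (gamma N u (proj q f)) + proj q (gamma N u (proj p f)).

Definition op_prod (s : seq (M -> M)) : M -> M := foldr comp id s.

Definition Psi_ q (a : M -> M) : C :=
  inner (a (ket R (vacuum q))) (ket R (vacuum q)).

Definition Psi (a : M -> M) : C := \sum_q (d q)%:C * Psi_ q a.

Lemma creation_ket p q u w : creation p q u (ket R w) =
  if start w == q then (Num.sqrt (d p))%:C *: ket R (push p u w) else 0.
Proof.
apply: l2_ext => v; rewrite (fun_if (fun g : M => g v)) l2_scaleE ketE l2_0E.
rewrite -[LHS]/(creation_fun p q u (ket R w) v).
case: v => [[|x s] t]; rewrite /creation_fun.
  have -> : (([::], t) == push p u w :> word) = false by apply/eqP.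
  by rewrite mulr0 if_same.
have -> : ((x :: s, t) == push p u w :> word)
    = (x == (p, u)) && ((s, t) == w :> word).
  apply/eqP/andP => [[-> -> ->]|[/eqP-> /eqP<-]//].
  by rewrite !eqxx; split=> //; case: (w).
rewrite -[LHS]/(if (x == (p, u)) && (start (s, t) == q)
                then (Num.sqrt (d p))%:C * ket R w (s, t) else 0) ketE.
case: (@eqVneq word (s, t) w) => [<-|_] /=; last by rewrite andbF !mulr0 !if_same.
by rewrite andbT; case: (x == _); rewrite ?mulr0 ?if_same.
Qed.

Lemma inner_creation p q u f g :
  inner (creation p q u f) g = inner f (annihilation p q u g).
Proof.
pose h w := creation p q u f w * conjc (g w).
have h0 w : ~ (push p u @` [set w | start w == q]) w -> h w = 0.
  by move=> /creation_fun_supp hw; rewrite /h /creation /= hw mul0r.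
have hE w : (if start w == q then h (push p u w) else 0) =
    f w * conjc (annihilation p q u g w).
  rewrite /h -[creation _ _ _ _ _]/(creation_fun p q u f _) creation_fun_push.
  rewrite -[annihilation _ _ _ _ _]/(annihilation_fun p q u g w)
    /annihilation_fun.
  case: (start w == q); last by rewrite conjc0 mulr0.
  have -> (a : R) (z : C) : conjc (a%:C * z) = a%:C * conjc z.
    by case: z => x y; rewrite /=; simpc.
  by rewrite -mulrA mulrCA.
rewrite /inner /csum; apply: (congr2 (@Complex R)).
- rewrite (rsum_reindex (A := fun w => start w == q) (@push_inj p u)).
    by congr rsum; apply/funext => w; rewrite -hE; case: ifP.
  by move=> w /h0; rewrite /h => ->.
- rewrite (rsum_reindex (A := fun w => start w == q) (@push_inj p u)).
    by congr rsum; apply/funext => w; rewrite -hE; case: ifP.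
  by move=> w /h0; rewrite /h => ->.
Qed.

Lemma adjoint_creation p q u : adjoint (creation p q u) = annihilation p q u.
Proof. by apply: adjoint_eq => f g; exact: inner_creation. Qed.

Lemma adjoint_wp u :
  adjoint (wp u) = (fun f => \sum_p \sum_q annihilation p q u f).
Proof.
apply: adjoint_eq => f g; rewrite /wp.
elim/big_rec2 : _ => [|p x y _ IH]; first by rewrite inner0l inner0r.
rewrite innerDl innerDr IH; congr (_ + _).
elim/big_rec2 : _ => [|q x' y' _ IH']; first by rewrite inner0l inner0r.
by rewrite innerDl innerDr IH' inner_creation.
Qed.

Lemma proj_ket q w : proj q (ket R w) = if start w == q then ket R w else 0.
Proof.
apply: l2_ext => v; rewrite -[LHS]/(if start v == q then ket R w v else 0).
rewrite (fun_if (fun g : M => g v)) l2_0E ketE.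
by case: (@eqVneq word v w) => [->//|_]; rewrite !if_same.
Qed.

Lemma proj_idem q f : proj q (proj q f) = proj q f.
Proof.
by apply: l2_ext => w; rewrite /proj /= /proj_fun; case: (start w == q).
Qed.

Lemma proj_selfadj q : adjoint (proj q) = proj q.
Proof.
apply: adjoint_eq => f g; rewrite /inner; congr csum; apply/funext => w.
rewrite /proj /= /proj_fun.
by case: (start w == q) => //; rewrite conjc0 mul0r mulr0.
Qed.

Lemma Psi_E q a : Psi_ q a = a (ket R (vacuum q)) (vacuum q).
Proof. exact: inner_ketr. Qed.

End Fock.

Section IntervalPartition.
Variables (r n : nat).

Definition is_interval (A : {set 'I_n}) : Prop :=
  forall i j k : 'I_n, i \in A -> k \in A -> (i <= j <= k)%N -> j \in A.

Definition interval_partition (N : 'I_r -> {set 'I_n}) : Prop :=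
  [/\ forall q, (0 < #|N q|)%N,
      forall p q j, j \in N p -> j \in N q -> p = q,
      forall j, exists q, j \in N q
    & forall q, is_interval (N q)].

End IntervalPartition.

Section Matrices.
Variables (R : realType) (n : nat).
Local Notation C := R[i].

Definition diag_ind (A : {set 'I_n}) : 'M[C]_n :=
  diag_mx (\row_j (j \in A)%:R).

Definition sym_block (r : nat) (N : 'I_r -> {set 'I_n}) (p q : 'I_r)
    (Y : 'M[C]_n) : 'M[C]_n :=
  if p == q then diag_ind (N q) *m Y *m diag_ind (N q)
  else diag_ind (N p) *m Y *m diag_ind (N q)
       + diag_ind (N q) *m Y *m diag_ind (N p).

Definition eucl_norm (v : 'cV[C]_n) : R :=
  Num.sqrt (\sum_i normc (v i 0) ^+ 2).

Definition op_norm (A : 'M[C]_n) : R :=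
  sup [set eucl_norm (A *m v) | v in [set v | eucl_norm v <= 1]].

End Matrices.

Section RandomMatrices.
Variables (R : realType) (disp : measure_display) (T : measurableType disp).
Variable P : probability T R.
Local Notation C := R[i].

Definition cexpectation (X : T -> C) : C :=
  fine ('E_P[fun t => complex.Re (X t)])
    +i* fine ('E_P[fun t => complex.Im (X t)]).

Definition in_all_Lp (X : T -> C) : Prop :=
  forall p : R, 1 <= p ->
    (fun t => complex.Re (X t)) \in Lfun P p%:E /\
    (fun t => complex.Im (X t)) \in Lfun P p%:E.

Definition tau n (A : T -> 'M[C]_n) : C :=
  n%:R^-1 * \sum_j cexpectation (fun t => A t j j).

Definition sigma_entries n (A : T -> 'M[C]_n) : set (set T) :=
  <<s [set E | exists i j (B : set R), measurable B /\
        (E = (fun t => complex.Re (A t i j)) @^-1` B \/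
         E = (fun t => complex.Im (A t i j)) @^-1` B)] >>.

Definition independent_sigma (K : choiceType) (S : K -> set (set T)) : Prop :=
  forall (s : seq K) (E : K -> set T), uniq s ->
    (forall k, k \in s -> S k (E k)) ->
    P (\bigcap_(k in [set` s]) E k) = (\prod_(k <- s) P (E k))%E.

End RandomMatrices.

Section Freeness.
Variables (R : realType) (A : algType R[i]).

Definition unital_subalg_gen (S : set A) : set A :=
  smallest (fun B : set A => GRing.subalg_closed (mem B)) S.

Definition free_families (K : eqType) (phi : A -> R[i]) (S : K -> set A) : Prop :=
  forall s : seq (K * A), s != [::] -> sorted (fun x y => x.1 != y.1) s ->
    (forall x, x \in s -> unital_subalg_gen (S x.1) x.2 /\ phi x.2 = 0) ->
    phi (\prod_(x <- s) x.2) = 0.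

End Freeness.

Section Asymptotics.
Variables (R : realType) (disp : measure_display) (T : measurableType disp).
Variables (P : probability T R) (r : nat) (U : finType).
Local Notation C := R[i].

(* The regular module [C^o] carries the norm topology of the complex plane;
   the bare type [R[i]] has no canonical topology *)
Definition converges (x : nat -> C) (l : C) : Prop :=
  (fun n => x n : C^o) @ \oo --> (l : C^o).

(* A mixed moment of order [m] of the canonical variables is the one in which
   every series is truncated at [k <= m]; truncation at any [k <= N] with
   [N >= m] gives the same value *)
Definition same_limit_moments (d : 'I_r -> R) (kappa : U -> nat -> R)
    (Y : U -> forall n, T -> 'M[C]_n) : Prop :=
  forall us : seq U,
    converges (fun n => tau P (fun t => \prod_(u <- us) Y u n t))
      (Psi d (op_prod [seq gamma d kappa (size us) u | u <- us])).

Definition asymptotically_free (Y : U -> forall n, T -> 'M[C]_n)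
    (D : 'I_r -> forall n, 'M[C]_n) : Prop :=
  exists (A : algType C) (phi : {scalar A}) (y : U -> A) (e : 'I_r -> A),
    [/\ phi 1 = 1,
        free_families phi (fun b : bool => if b then range y else range e)
      & forall w : seq (U + 'I_r),
          converges
            (fun n => tau P (fun t => \prod_(x <- w)
               match x with inl u => Y u n t | inr q => D q n end))
            (phi (\prod_(x <- w)
               match x with inl u => y u | inr q => e q end))].

End Asymptotics.

(* Main.v *)
(* In the limit algebra the blocks T_{p,q}(u,n) become e_p y_u e_q + e_q y_u e_p
   (or e_q y_u e_q), where the family y is free from the family e, so that the
   limit of the moments exists and is a joint moment of y and e. The joint
   distribution of two free families is determined by their marginals (expand
   an alternating product into centred factors and shorter products). The
   marginal of y is that of the gamma(u), by assumption, the marginal of e is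
   that of the P_q, because n_q / n tends to d_q; hence everything reduces to
   the freeness of the gamma(u) from the P_q under Psi.

   For that, call a vector vacuum-like if every wp(u)^* kills it. On a
   vacuum-like vector xi a polynomial a in the gamma(u) acts as a polynomial
   in the wp(u) with constant term Psi(a), so if a is centred, then a xi is a
   sum of vectors wp(u) zeta. As wp(v)^* b wp(u) = delta_{u,v} Psi(b) for b in
   the span of the P_q, a centred b maps wp(u) zeta to a vacuum-like vector.
   Starting at Omega_q, an alternating product of centred elements containing
   some a therefore has no component along Omega_q. *)
Require Import Defs.
From mathcomp Require Import all_boot all_order all_algebra.
From mathcomp Require Import all_classical all_reals all_analysis.
From mathcomp Require Import measurable_realfun.
Import Order.TTheory GRing.Theory Num.Theory numFieldNormedType.Exports.
From mathcomp.real_closed Require Import complex.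

Set Implicit Arguments.
Unset Strict Implicit.
Unset Printing Implicit Defensive.

Local Open Scope classical_set_scope.
Local Open Scope ring_scope.
Local Open Scope complex_scope.

(** * Creation operators on the Fock space, and independence of the truncation *)

Section FockOperators.
Variables (R : realType) (r : nat) (U : finType).
Variables (d : 'I_r -> R) (kappa : U -> nat -> R).
Local Notation C := R[i].
Local Notation M := (l2 R (word r U)).
Local Notation op := (M -> M).

Local Notation sd p := ((Num.sqrt (d p))%:C : C).
Local Notation wp := (@wp R r U d).
Local Notation proj := (@Defs.proj R r U).

Definition oplinear (X : op) : Prop :=
  forall (a : C) (f g : M), X (a *: f + g) = a *: X f + X g.

(** [adjoint] picks an operator by choice; this explicit form, equal to the adjoint of [wp u] by
    [adjoint_wp], can be computed with. *)
Definition wpstar (u : U) : op := fun f => \sum_p \sum_q annihilation d p q u f.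

Lemma wp_nil u (f : M) (q : 'I_r) : wp u f ([::], q) = 0.
Proof. by rewrite /wp l2_sumE big1// => p _; rewrite l2_sumE big1. Qed.

(** Summing over all index pairs removes the matching condition: at [x :: s] only the pair read off
    from [x] and from the start of the tail can contribute. *)
Lemma wp_cons u (f : M) x s q :
  wp u f (x :: s, q) = if x.2 == u then sd x.1 * f (s, q) else 0.
Proof.
rewrite /wp l2_sumE.
under eq_bigr => p _ do rewrite l2_sumE.
rewrite (bigD1 x.1)//= [X in _ + X]big1 ?addr0; last first.
  move=> p /negPf px; rewrite big1// => q' _.
  by rewrite /creation /= /creation_fun/= -pair_eqE /= eq_sym px.
rewrite (bigD1 (start (s, q)))//= [X in _ + X]big1 ?addr0; last first.
  move=> q' /negPf px; rewrite /creation /= /creation_fun/=.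
  by rewrite [_ == q']eq_sym px andbF.
by rewrite /creation /= /creation_fun/= eqxx andbT -pair_eqE /= eqxx.
Qed.

Lemma wpstarE u (f : M) w : wpstar u f w = \sum_p sd p * f (push p u w).
Proof.
rewrite /wpstar l2_sumE; apply: eq_bigr => p _.
rewrite l2_sumE (bigD1 (start w))//= [X in _ + X]big1 ?addr0; last first.
  by move=> q /negPf wq; rewrite /annihilation /= /annihilation_fun eq_sym wq.
by rewrite /annihilation /= /annihilation_fun eqxx.
Qed.

Lemma gammaE N u (f : M) : gamma d kappa N u f =
  wpstar u f + \sum_(k < N.+1) (kappa u k.+1)%:C *: iter k (wp u) f.
Proof. by rewrite /gamma adjoint_wp. Qed.

Lemma wp_linear u : oplinear (wp u).
Proof.
move=> a f g; apply: l2_ext => -[[|x s] q]; rewrite [RHS]l2_addE l2_scaleE.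
  by rewrite !wp_nil mulr0 addr0.
rewrite !wp_cons l2_addE l2_scaleE; case: ifP => _; last by rewrite mulr0 addr0.
by rewrite mulrDr !mulrA [a * _]mulrC.
Qed.

Lemma wpstar_linear u : oplinear (wpstar u).
Proof.
move=> a f g; apply: l2_ext => w; rewrite [RHS]l2_addE l2_scaleE !wpstarE.
rewrite mulr_sumr -big_split; apply: eq_bigr => p _.
by rewrite l2_addE l2_scaleE mulrDr !mulrA [a * _]mulrC.
Qed.

Lemma oplinear_iter k (X : op) : oplinear X -> oplinear (iter k X).
Proof. by move=> lX a f g; elim: k => //= k ->. Qed.

Lemma oplinear_comp (X Z : op) : oplinear X -> oplinear Z -> oplinear (X \o Z).
Proof. by move=> lX lZ a f g /=; rewrite lZ lX. Qed.

Lemma oplinear_lin (a : C) (X Z : op) : oplinear X -> oplinear Z ->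
  oplinear (a *: X + Z : op).
Proof.
move=> lX lZ b f g.
rewrite -[LHS]/(a *: X (b *: f + g) + Z (b *: f + g)).
rewrite -[RHS]/(b *: (a *: X f + Z f) + (a *: X g + Z g)) lX lZ.
by rewrite !scalerDr !scalerA [b * a]mulrC addrACA.
Qed.

Lemma gamma_linear N u : oplinear (gamma d kappa N u).
Proof.
move=> a f g; rewrite !gammaE wpstar_linear scalerDr addrACA; congr (_ + _).
rewrite scaler_sumr -big_split; apply: eq_bigr => k _ /=.
by rewrite (oplinear_iter k (@wp_linear u)) scalerDr !scalerA [a * _]mulrC.
Qed.

Lemma projE q (f : M) w : proj q f w = if start w == q then f w else 0.
Proof. by []. Qed.

Lemma proj_linear q : oplinear (proj q).
Proof.
move=> a f g; apply: l2_ext => w; rewrite [RHS]l2_addE l2_scaleE !projE l2_addE.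
by case: ifP; rewrite ?l2_scaleE// mulr0 addr0.
Qed.

Lemma op_prod_cat (s1 s2 : seq op) f :
  op_prod (s1 ++ s2) f = op_prod s1 (op_prod s2 f).
Proof. by elim: s1 => //= X s1 ->. Qed.

Lemma PsiE (X : op) :
  Psi d X = \sum_q (d q)%:C * X (ket R (vacuum U q)) (vacuum U q).
Proof. by apply: eq_bigr => q _; rewrite Psi_E. Qed.

Lemma Psi_lin (a : C) (X Z : op) : Psi d (a *: X + Z) = a * Psi d X + Psi d Z.
Proof.
rewrite !PsiE mulr_sumr -big_split; apply: eq_bigr => q _.
by rewrite [RHS]addrC mulrCA addrC -mulrDr.
Qed.

Definition agree m (f g : M) := forall w, (size w.1 <= m)%N -> f w = g w.

Lemma iter_wp_small k u (f : M) w : (size w.1 < k)%N -> iter k (wp u) f w = 0.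
Proof.
elim: k w => // k IH [[|x s] q] /= sk; first by rewrite wp_nil.
by rewrite wp_cons IH// mulr0 if_same.
Qed.

Lemma agree_iter_wp k u m (f g : M) : agree m f g ->
  agree m (iter k (wp u) f) (iter k (wp u) g).
Proof.
elim: k => //= k IH fg [[|x s] q] sm; first by rewrite !wp_nil.
by rewrite !wp_cons (IH fg (s, q))// ltnW.
Qed.

(** [wpstar] reads coefficients at words one letter longer, hence [m.+1]. Powers of [wp] above [m]
    vanish at words of length at most [m], so both truncations keep every term that matters. *)
Lemma agree_gamma N N' u m (f g : M) : (m <= N)%N -> (m <= N')%N ->
  agree m.+1 f g -> agree m (gamma d kappa N u f) (gamma d kappa N' u g).
Proof.
move=> mN mN' fg w wm; rewrite !gammaE !l2_addE; congr (_ + _).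
  by rewrite !wpstarE; apply: eq_bigr => p _; rewrite fg.
have trunc K (h : M) : (m <= K)%N ->
    (\sum_(k < K.+1) (kappa u k.+1)%:C *: iter k (wp u) h) w =
    \sum_(k < m.+1) (kappa u k.+1)%:C * iter k (wp u) h w.
  move=> mK; rewrite l2_sumE.
  rewrite (@big_ord_widen _ _ _ m.+1 K.+1
    (fun k => (kappa u k.+1)%:C * iter k (wp u) h w))//.
  rewrite [RHS]big_mkcond; apply: eq_bigr => k _; rewrite l2_scaleE.
  case: ifPn => //; rewrite -leqNgt => mk; rewrite iter_wp_small ?mulr0//.
  exact: leq_ltn_trans wm mk.
rewrite !trunc//; apply: eq_bigr => k _; congr (_ * _).
by apply: (@agree_iter_wp k u m f g _ w wm) => v vm; apply: fg; exact: leqW.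
Qed.

(** Each factor costs one unit of word length, whence [m + size us]. *)
Lemma agree_gamma_prod N N' us m f : (m + size us <= N)%N ->
  (m + size us <= N')%N ->
  agree m (op_prod [seq gamma d kappa N u | u <- us] f)
          (op_prod [seq gamma d kappa N' u | u <- us] f).
Proof.
elim: us m => [|u us IH] m /= mN mN'; first by move=> w.
by apply: agree_gamma; rewrite ?(leq_trans (leq_addr _ _) mN)
  ?(leq_trans (leq_addr _ _) mN')//; apply: IH; rewrite addSnnS.
Qed.

(** Only coefficients at the [Omega_q], words of length [0], enter [Psi]. *)
Lemma Psi_gamma_trunc N N' us : (size us <= N)%N -> (size us <= N')%N ->
  Psi d (op_prod [seq gamma d kappa N u | u <- us]) =
  Psi d (op_prod [seq gamma d kappa N' u | u <- us]).
Proof.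
move=> sN sN'; rewrite !PsiE; apply: eq_bigr => q _; congr (_ * _).
exact: (agree_gamma_prod (m := 0)).
Qed.

End FockOperators.

(** * Canonical variables and the span of the [P_q] acting on vacuum-like and created vectors *)

Section VacuumFreeness.
Variables (R : realType) (r : nat) (U : finType).
Variables (d : 'I_r -> R) (kappa : U -> nat -> R).
Hypotheses (d_ge0 : forall q, 0 <= d q) (d_sum1 : \sum_q d q = 1).
Local Notation C := R[i].
Local Notation M := (l2 R (word r U)).
Local Notation op := (M -> M).
Local Notation wp := (@wp R r U d).
Local Notation wpstar := (@wpstar R r U d).
Local Notation ketv q := (ket R (vacuum U q)).

Lemma sum_dC : \sum_q (d q)%:C = 1 :> C.
Proof. by rewrite -rmorph_sum d_sum1 rmorph1. Qed.

(** These are the combinations of the [P_q]; in this form products and linear combinations merely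
    combine the functions [b]. *)
Definition diagonal_op (X : op) : Prop :=
  exists b : 'I_r -> C, forall f w, X f w = b (start w) * f w.

Lemma diagonal_proj_word qs :
  diagonal_op (op_prod [seq @Defs.proj R r U q | q <- qs]).
Proof.
elim: qs => [|q qs [b bE]] /=; first by exists (fun=> 1) => f w; rewrite mul1r.
exists (fun p => (p == q)%:R * b p) => f w; rewrite projE bE.
by case: (start w == q); rewrite ?mul1r// !mul0r.
Qed.

Lemma diagonal_lin (a : C) (X Z : op) :
  diagonal_op X -> diagonal_op Z -> diagonal_op (a *: X + Z).
Proof.
move=> [b bE] [b' bE']; exists (fun p => a * b p + b' p) => f w.
by rewrite mulrDl -mulrA -bE -bE'.
Qed.

Lemma Psi_diagonal (X : op) (b : 'I_r -> C) :
  (forall f w, X f w = b (start w) * f w) -> Psi d X = \sum_q (d q)%:C * b q.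
Proof.
by move=> XE; rewrite PsiE; apply: eq_bigr => q _; rewrite XE ketE eqxx mulr1.
Qed.

(* The source of freeness: with [u = v] this is [wp^* X wp = Psi(X)]. *)
Lemma wpstar_diagonal_wp (X : op) u v f : diagonal_op X ->
  wpstar v (X (wp u f)) = ((v == u)%:R * Psi d X) *: f.
Proof.
move=> [b bE]; apply: l2_ext => w; rewrite l2_scaleE (Psi_diagonal bE).
rewrite wpstarE mulr_sumr mulr_suml; apply: eq_bigr => p _.
rewrite bE /push wp_cons -surjective_pairing /=.
case: (v == u); rewrite ?mulr0n ?mulr1n; last by rewrite !(mulr0, mul0r).
have -> : (d p)%:C = (Num.sqrt (d p))%:C * (Num.sqrt (d p))%:C :> C.
  by rewrite -rmorphM -expr2 sqr_sqrtr.
rewrite mul1r -[start _]/p -!mulrA; congr (_ * _).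
by rewrite mulrCA.
Qed.

(** For [X = id] the factor [Psi d X] is the total weight, which [d_sum1] makes [1]; this is the
    relation satisfied by free creation operators. *)
Lemma wpstar_wp u v f : wpstar v (wp u f) = (v == u)%:R *: f.
Proof.
have X1 (g : M) w : idfun g w = 1 * g w by rewrite mul1r.
rewrite -[LHS]/(wpstar v (idfun (wp u f))) wpstar_diagonal_wp;
  last by exists (fun=> 1).
by rewrite [Psi _ _](@Psi_diagonal idfun (fun=> 1) X1) -mulr_suml sum_dC !mulr1.
Qed.

Definition vacuum_like (xi : M) : Prop := forall u, wpstar u xi = 0.

Definition created (f : M) : Prop :=
  exists z : U -> M, f = \sum_u wp u (z u).

Lemma vacuum_like_vacuum q : vacuum_like (ketv q).
Proof.
move=> u; apply: l2_ext => w; rewrite wpstarE big1// => p _.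
by rewrite ketE mulr0.
Qed.

Lemma created_vacuum f q : created f -> f (vacuum U q) = 0.
Proof. by case=> z ->; rewrite l2_sumE big1// => u _; rewrite wp_nil. Qed.

Lemma oplinear0 (X : op) : oplinear X -> X 0 = 0.
Proof.
move=> lX; have /eqP := lX 1 0 0; rewrite !scale1r addr0.
by rewrite -subr_eq0 opprD addNKr oppr_eq0 => /eqP.
Qed.

Lemma oplinear_sum (X : op) (J : Type) (s : seq J) (F : J -> M) : oplinear X ->
  X (\sum_(j <- s) F j) = \sum_(j <- s) X (F j).
Proof.
move=> lX; elim: s => [|j s IH]; first by rewrite !big_nil oplinear0.
by rewrite !big_cons -[F j]scale1r lX !scale1r IH.
Qed.

Lemma vacuum_like_diagonal_vacuum X q : diagonal_op X ->
  vacuum_like (X (ketv q)).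
Proof.
move=> [b bE] u; apply: l2_ext => w; rewrite wpstarE big1// => p _.
by rewrite bE ketE !mulr0.
Qed.

Lemma vacuum_like_diagonal_created X f : diagonal_op X -> oplinear X ->
  Psi d X = 0 -> created f -> vacuum_like (X f).
Proof.
move=> dX lX X0 [z ->] u.
rewrite (oplinear_sum _ _ lX) (oplinear_sum _ _ (@wpstar_linear _ _ _ d u)).
by rewrite big1// => v _; rewrite wpstar_diagonal_wp// X0 mulr0 scale0r.
Qed.

(* Noncommutative polynomials in the [wp u], with their constant terms. *)
Inductive creation_poly : C -> op -> Prop :=
| creation_poly_word us : creation_poly (us == [::])%:R (op_prod (map wp us))
| creation_poly_lin a c X c' X' : creation_poly c X -> creation_poly c' X' ->
    creation_poly (a * c + c') (a *: X + X').

(** No constructor yields zero directly; it is obtained as [- id + id]. *)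
Lemma creation_poly0 : creation_poly 0 0.
Proof.
have := creation_poly_lin (-1) (creation_poly_word [::]) (creation_poly_word [::]).
by rewrite eqxx mulN1r addNr scaleN1r addNr.
Qed.

(** The annihilator meets the leftmost letter of a word and either cancels it or gives zero; past
    the empty word it reaches [xi] and kills it. *)
Lemma wpstar_creation_poly v c X : creation_poly c X ->
  exists c' X', creation_poly c' X' /\
    forall xi, vacuum_like xi -> wpstar v (X xi) = X' xi.
Proof.
elim=> [[|u us]|a c1 X1 c2 X2 _ [c1' [X1' [P1 E1]]] _ [c2' [X2' [P2 E2]]]].
- by exists 0, 0; split; [exact: creation_poly0|move=> xi vxi; exact: vxi].
- exists ((v == u)%:R * (us == [::])%:R + 0),
    ((v == u)%:R *: op_prod (map wp us) + 0).
  split=> [|xi _];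
    last by rewrite addr0 /= wpstar_wp.
  exact: creation_poly_lin (creation_poly_word us) creation_poly0.
- exists (a * c1' + c2'), (a *: X1' + X2'); split=> [|xi vxi].
    exact: creation_poly_lin.
  rewrite -[LHS]/(wpstar v (a *: X1 xi + X2 xi)) wpstar_linear E1// E2//.
Qed.

Lemma wp_creation_poly u c X : creation_poly c X -> creation_poly 0 (wp u \o X).
Proof.
elim=> [us|a c1 X1 c2 X2 _ P1 _ P2]; first exact: (creation_poly_word (u :: us)).
rewrite (_ : _ \o _ = a *: (wp u \o X1) + (wp u \o X2)); last first.
  by apply/funext => f; exact: wp_linear.
by have := creation_poly_lin a P1 P2; rewrite mulr0 addr0.
Qed.

Lemma iter_wp_creation_poly u k c X : creation_poly c X ->
  exists c', creation_poly c' (iter k (wp u) \o X).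
Proof.
move=> P; elim: k => [|k [c' IH]]; first by exists c.
by exists 0; exact: (wp_creation_poly u IH).
Qed.

(** The annihilation part requires [xi] to be vacuum-like; the powers of [wp v] turn a polynomial
    into a polynomial on every vector. *)
Lemma gamma_creation_poly N v c X : creation_poly c X ->
  exists c' X', creation_poly c' X' /\
    forall xi, vacuum_like xi -> gamma d kappa N v (X xi) = X' xi.
Proof.
move=> P; have [c1 [X1 [P1 E1]]] := wpstar_creation_poly v P.
have [c2 [X2 [P2 E2]]] : exists c' X', creation_poly c' X' /\ forall xi,
    \sum_(k < N.+1) (kappa v k.+1)%:C *: iter k (wp v) (X xi) = X' xi.
  elim: N.+1 => [|n [c' [X' [P' E']]]].
    by exists 0, 0; split=> [|xi]; [exact: creation_poly0|rewrite big_ord0].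
  have [c3 P3] := iter_wp_creation_poly v n P.
  exists ((kappa v n.+1)%:C * c3 + c'),
    ((kappa v n.+1)%:C *: (iter n (wp v) \o X) + X'); split=> [|xi].
    exact: creation_poly_lin.
  by rewrite big_ord_recr /= E' addrC.
exists (1 * c1 + c2), (1 *: X1 + X2); split=> [|xi vxi].
  exact: creation_poly_lin.
by rewrite gammaE E1// E2 scale1r.
Qed.

(** A nonempty word starts with some [wp u], so its values are created vectors; modulo these, only
    the constant term acts. *)
Lemma creation_poly_const c X : creation_poly c X ->
  forall xi, exists2 f, created f & X xi = c *: xi + f.
Proof.
elim=> [[|u us]|a c1 X1 c2 X2 _ IH1 _ IH2] xi.
- exists 0; last by rewrite scale1r addr0.
  exists (fun=> 0); rewrite big1// => u _.
  exact: oplinear0 (@wp_linear _ _ _ d u).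
- exists (wp u (op_prod (map wp us) xi)); last by rewrite scale0r add0r.
  exists (fun v => if v == u then op_prod (map wp us) xi else 0).
  rewrite (bigD1 u)//= eqxx big1 ?addr0// => v /negPf ->.
  exact: oplinear0 (@wp_linear _ _ _ d v).
- have [_ [z1 ->] E1] := IH1 xi; have [_ [z2 ->] E2] := IH2 xi.
  exists (a *: (\sum_u wp u (z1 u)) + \sum_u wp u (z2 u)).
    exists (fun u => a *: z1 u + z2 u); rewrite scaler_sumr -big_split.
    by apply: eq_bigr => u _; rewrite wp_linear.
  rewrite -[LHS]/(a *: X1 xi + X2 xi) E1 E2 scalerDr scalerA scalerDl addrACA.
  by [].
Qed.

(** Equality is asked on vacuum-like vectors only, because [gamma] contains [wpstar] and is not
    itself a polynomial in the [wp u]. *)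
Definition creative (X : op) : Prop :=
  exists c Z, creation_poly c Z /\ forall xi, vacuum_like xi -> X xi = Z xi.

Lemma creative_lin a X Z : creative X -> creative Z -> creative (a *: X + Z).
Proof.
move=> [c [X' [P E]]] [c' [Z' [P' E']]].
exists (a * c + c'), (a *: X' + Z'); split=> [|xi vxi].
  exact: creation_poly_lin.
by rewrite -[LHS]/(a *: X xi + Z xi) E// E'.
Qed.

Lemma creative_gamma_word N us :
  creative (op_prod [seq gamma d kappa N u | u <- us]).
Proof.
elim: us => [|u us [c [X [P E]]]].
  by exists 1, id; split=> //; have := creation_poly_word [::].
have [c' [X' [P' E']]] := gamma_creation_poly N u P.
by exists c', X'; split=> // xi vxi /=; rewrite E// E'.
Qed.

Lemma created_creative X xi : creative X -> Psi d X = 0 -> vacuum_like xi ->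
  created (X xi).
Proof.
move=> [c [Z [P E]]] X0 vxi; suff c0 : c = 0.
  have [f cf Zf] := creation_poly_const P xi.
  by rewrite E// Zf c0 scale0r add0r.
(* The constant term is [Psi d X]: at each [Omega_q] the created part has no vacuum component, so
   the coefficient is [c], and the weights sum to [1]. *)
rewrite -X0 PsiE -[LHS]mul1r -sum_dC mulr_suml; apply: eq_bigr => q _.
congr (_ * _); rewrite E; last exact: vacuum_like_vacuum.
have [f cf ->] := creation_poly_const P (ketv q).
by rewrite l2_addE l2_scaleE (created_vacuum _ cf) ketE eqxx mulr1 addr0.
Qed.

End VacuumFreeness.

(** * Joint moments of two free families: comparison of [phi] with [Psi] *)

Section JointMoments.
Variables (R : realType) (r : nat) (U : finType).
Variables (d : 'I_r -> R) (kappa : U -> nat -> R).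
Hypotheses (d_ge0 : forall q, 0 <= d q) (d_sum1 : \sum_q d q = 1).
Local Notation C := R[i].
Local Notation M := (l2 R (word r U)).
Local Notation op := (M -> M).
Local Notation letter := (U + 'I_r)%type.
Variables (A : algType C) (phi : {scalar A}) (y : U -> A) (e : 'I_r -> A).
Variables (K : nat) (T : Type).
Variables (Y : U -> forall n, T -> 'M[C]_n) (D : 'I_r -> forall n, 'M[C]_n).

Definition limit_letter (l : letter) : A :=
  match l with inl u => y u | inr q => e q end.
Definition op_letter (l : letter) : op :=
  match l with inl u => gamma d kappa K u | inr q => @Defs.proj R r U q end.
Definition matrix_letter (l : letter) (n : nat) (t : T) : 'M[C]_n :=
  match l with inl u => Y u n t | inr q => D q n end.
Definition is_Y (l : letter) : bool := if l is inl _ then true else false.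

(* [joint_span Q m x X Z]: one and the same linear combination of words with letters
   in [Q] and at most [m] letters [Y] takes the value [x] at the limit
   variables, [X] at the operators on [M] and [Z] at the random matrices. *)
Inductive joint_span (Q : pred letter) (m : nat) :
    A -> op -> (forall n, T -> 'M[C]_n) -> Prop :=
| joint_span_word w : all Q w -> (count is_Y w <= m)%N ->
    joint_span Q m (\prod_(l <- w) limit_letter l) (op_prod (map op_letter w))
      (fun n t => \prod_(l <- w) matrix_letter l n t)
| joint_span_lin a x X Z x' X' Z' :
    joint_span Q m x X Z -> joint_span Q m x' X' Z' ->
    joint_span Q m (a *: x + x') (a *: X + X') (fun n t => a *: Z n t + Z' n t).

Lemma op_letter_linear l : oplinear (op_letter l).
Proof. by case: l => a; [exact: gamma_linear|exact: proj_linear]. Qed.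

Lemma op_word_linear w : oplinear (op_prod (map op_letter w)).
Proof.
elim: w => [|l w IH]; first by move=> a f g.
exact: oplinear_comp (op_letter_linear l) IH.
Qed.

Lemma joint_span_oplinear Q m x X Z : joint_span Q m x X Z -> oplinear X.
Proof.
elim=> [w _ _|a x1 X1 Z1 x2 X2 Z2 _ lX1 _ lX2]; first exact: op_word_linear.
exact: oplinear_lin.
Qed.

Lemma eq_joint_span Q m x X Z x' X' Z' : joint_span Q m x X Z -> x = x' -> X =1 X' ->
  (forall n t, Z n t = Z' n t) -> joint_span Q m x' X' Z'.
Proof.
move=> S <- /funext <- ZZ'.
suff <- : Z = Z' by [].
by apply: functional_extensionality_dep => n; apply/funext.
Qed.

(** Induction on both factors. Distributing a word over a sum to its right requires
    [op_word_linear], as [M -> M] also contains nonlinear maps. *)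
Lemma joint_span_mul Q m m' x X Z x' X' Z' :
  joint_span Q m x X Z -> joint_span Q m' x' X' Z' ->
  joint_span Q (m + m') (x * x') (X \o X') (fun n t => Z n t *m Z' n t).
Proof.
elim=> [w Qw wm|a x1 X1 Z1 x2 X2 Z2 _ IH1 _ IH2] S'; last first.
  apply: eq_joint_span (joint_span_lin a (IH1 S') (IH2 S')) _ _ _ => //.
    by rewrite mulrDl scalerAl.
  by move=> n t; rewrite mulmxDl scalemxAl.
elim: S' => [w' Qw' wm'|a x1 X1 Z1 x2 X2 Z2 _ IH1 _ IH2].
  have Qc : all Q (w ++ w') by rewrite all_cat Qw.
  have cm : (count is_Y (w ++ w') <= m + m')%N by rewrite count_cat leq_add.
  apply: eq_joint_span (joint_span_word Qc cm) _ _ _; first by rewrite big_cat.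
    by move=> f; rewrite map_cat op_prod_cat.
  by move=> n t; rewrite big_cat.
apply: eq_joint_span (joint_span_lin a IH1 IH2) _ _ _.
- by rewrite mulrDr scalerAr.
- by move=> f; rewrite /= [RHS]op_word_linear.
- by move=> n t; rewrite mulmxDr scalemxAr.
Qed.

Lemma joint_span_letter (Q : pred letter) m (l : letter) : Q l -> (is_Y l <= m)%N ->
  joint_span Q m (limit_letter l) (op_letter l) (matrix_letter l).
Proof.
move=> Ql lm.
have Qw : all Q [:: l] by rewrite /= Ql.
have cw : (count is_Y [:: l] <= m)%N by rewrite /= addn0.
apply: eq_joint_span (joint_span_word Qw cw) _ _ _ => //; first by rewrite big_seq1.
by move=> n t; rewrite big_seq1.
Qed.

Lemma joint_span1 (Q : pred letter) m : joint_span Q m 1 id (fun n _ => 1%:M).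
Proof.
have Qw : all Q [::] by [].
have cw : (count is_Y [::] <= m)%N by [].
apply: eq_joint_span (joint_span_word Qw cw) _ _ _ => //; first by rewrite big_nil.
by move=> n t; rewrite big_nil.
Qed.

Definition pure (b : bool) : pred letter := fun l => is_Y l == b.

Lemma pure_true w : all (pure true) w -> exists us, w = map inl us.
Proof.
elim: w => [|[u|q] w IH] //=; first by exists [::].
by case/IH => us ->; exists (u :: us).
Qed.

Lemma pure_false w : all (pure false) w -> exists qs, w = map inr qs.
Proof.
elim: w => [|[u|q] w IH] //=; first by exists [::].
by case/IH => qs ->; exists (q :: qs).
Qed.

Lemma creative_span m x X Z : joint_span (pure true) m x X Z -> creative d X.
Proof.
elim=> [w /pure_true[us ->] _|a x1 X1 Z1 x2 X2 Z2 _ c1 _ c2].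
  by rewrite -map_comp; exact: creative_gamma_word.
exact: creative_lin.
Qed.

Lemma diagonal_span m x X Z : joint_span (pure false) m x X Z -> diagonal_op X.
Proof.
elim=> [w /pure_false[qs ->] _|a x1 X1 Z1 x2 X2 Z2 _ c1 _ c2].
  by rewrite -map_comp; exact: diagonal_proj_word.
exact: diagonal_lin.
Qed.

Lemma subalg_span b m x X Z : joint_span (pure b) m x X Z ->
  unital_subalg_gen (if b then range y else range e) x.
Proof.
move=> S B [[B1 Blin Bmul] sB].
suff : x \in (mem B : {pred A}) by rewrite inE.
elim: S => [w|a x1 X1 Z1 x2 X2 Z2 _ c1 _ c2]; last exact: Blin.
elim: w => [|l w IH] /=; first by rewrite big_nil.
move=> /andP[/eqP lb Qw] /(leq_trans (leq_addl _ _)) cw.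
rewrite big_cons; apply: Bmul; last exact: IH.
rewrite inE; apply: sB; case: l lb => a /= <-; exists a => //.
Qed.

Hypothesis phi1 : phi 1 = 1.
Hypothesis phi_free :
  free_families phi (fun b : bool => if b then range y else range e).
Hypothesis phi_Y : forall us, (size us <= K)%N ->
  phi (\prod_(u <- us) y u) = Psi d (op_prod [seq gamma d kappa K u | u <- us]).
Hypothesis phi_D : forall qs,
  phi (\prod_(q <- qs) e q) = Psi d (op_prod [seq @Defs.proj R r U q | q <- qs]).

(** The marginals agree. The degree is tracked in [joint_span] for this purpose: [phi_Y] covers only
    words of length at most the truncation level [K]. *)
Lemma phi_pure b m x X Z : (m <= K)%N -> joint_span (pure b) m x X Z ->
  phi x = Psi d X.
Proof.
move=> mK; elim=> [w|a x1 X1 Z1 x2 X2 Z2 _ E1 _ E2]; last first.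
  by rewrite linearP Psi_lin E1 E2.
case: b => [/pure_true[us ->]|/pure_false[qs ->] _]; rewrite big_map -map_comp.
  rewrite count_map (eq_count (a2 := predT))// count_predT => usm.
  by rewrite phi_Y// (leq_trans usm).
exact: phi_D.
Qed.

(** A polynomial in one of the two families. Its three values are bundled, so that merging two
    blocks or subtracting a constant changes all of them consistently. *)
Record block := Block {
  block_Y : bool; block_deg : nat;
  block_lim : A; block_op : op; block_mx : forall n, T -> 'M[C]_n;
  block_span : joint_span (pure block_Y) block_deg block_lim block_op block_mx }.

Implicit Types (s : seq block) (z : block).

Definition blocks_lim s := \prod_(z <- s) block_lim z.
Definition blocks_op s := op_prod (map block_op s).
Definition blocks_deg s := (\sum_(z <- s) block_deg z)%N.
Definition alternating s := sorted (fun b b' => b != b') (map block_Y s).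

Lemma blocks_op_linear s : oplinear (blocks_op s).
Proof.
elim: s => [|z s IH]; first by move=> a f g.
exact: oplinear_comp (joint_span_oplinear (block_span z)) IH.
Qed.

Lemma blocks_op_cat s1 s2 f :
  blocks_op (s1 ++ s2) f = blocks_op s1 (blocks_op s2 f).
Proof. by rewrite /blocks_op map_cat op_prod_cat. Qed.

(** Blocks act from the right: a centred [Y] block takes vacuum-like vectors to created ones, a
    centred diagonal block takes created vectors back. A rightmost diagonal block only rescales
    [Omega_q]. *)
Lemma alternating_vector s q : alternating s ->
  all (fun z => Psi d (block_op z) == 0) s ->
  match s with
  | [::] => True
  | z :: _ => if block_Y z then created d (blocks_op s (ket R (vacuum U q)))
              else vacuum_like d (blocks_op s (ket R (vacuum U q)))
  end.
Proof.
elim: s => // z s IH /= alt /andP[/eqP z0 s0].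
have {IH} := IH (path_sorted alt) s0.
case: z z0 alt => b m x X Z S /= X0.
rewrite -[blocks_op (_ :: _)]/(X \o blocks_op s).
case: b S => S; case: s s0 => [|z' s] s0 /=.
- by move=> _ _; apply: created_creative => //;
    [exact: creative_span S|exact: vacuum_like_vacuum].
- case/andP; case: (block_Y z') => // _ _ v; apply: created_creative => //.
  exact: creative_span S.
- by move=> _ _; apply: vacuum_like_diagonal_vacuum; exact: diagonal_span S.
- case/andP; case: (block_Y z') => // _ _ v.
  apply: vacuum_like_diagonal_created => //; first exact: diagonal_span S.
  exact: joint_span_oplinear S.
Qed.

Lemma Psi_free s : (0 < size s)%N -> alternating s ->
  all (fun z => Psi d (block_op z) == 0) s -> Psi d (blocks_op s) = 0.
Proof.
case: s => // z s _ alt zs0.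
have /= := fun q => @alternating_vector (z :: s) q alt zs0.
case: z alt zs0 => b m x X Z S /= alt /andP[/eqP X0 s0].
rewrite -[blocks_op (_ :: _)]/(X \o blocks_op s); case: b S alt => S alt.
  move=> cr; rewrite PsiE big1// => q _.
  by rewrite (created_vacuum _ (cr q)) mulr0.
(* A lone diagonal block may have nonzero components along the single [Omega_q]; only their weighted
   sum vanishes. With more blocks, the tail starts with a [Y] block and gives a created vector, on
   which the leading diagonal block merely rescales coefficients. *)
case: s s0 alt => [|z' s] s0 alt _; first exact: X0.
have := fun q => @alternating_vector (z' :: s) q (path_sorted alt) s0.
move: alt => /= /andP[]; case: (block_Y z') => // _ _ cr.
have [b bE] := diagonal_span S.
rewrite PsiE big1// => q _.
by rewrite bE (created_vacuum _ (cr q)) !mulr0.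
Qed.

Lemma phi_free_blocks s : (0 < size s)%N -> alternating s ->
  all (fun z => phi (block_lim z) == 0) s -> phi (blocks_lim s) = 0.
Proof.
move=> s0 alt c.
have := phi_free (s := [seq (block_Y z, block_lim z) | z <- s]).
rewrite big_map => -> //; first by case: (s) s0.
  by move: alt; rewrite /alternating !sorted_map.
elim: (s) c => // z s' IH /= /andP[/eqP z0 c] x.
rewrite inE => /orP[/eqP ->|]; last exact: IH.
by split=> //=; exact: subalg_span (block_span z).
Qed.

Lemma not_alternating s : ~~ alternating s -> exists s1 z1 z2 s2,
  s = s1 ++ z1 :: z2 :: s2 /\ block_Y z1 = block_Y z2.
Proof.
elim: s => // z [|z' s] IH //; rewrite /alternating /= negb_and negbK.
case/orP=> [/eqP zz'|/IH[s1 [z1 [z2 [s2 [-> E]]]]]].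
  by exists [::], z, z', s.
by exists (z :: s1), z1, z2, s2.
Qed.

(** Strong induction on the number of blocks. Equal neighbours are merged; an alternating product is
    centred block by block, each correction being a shorter product, until freeness makes both sides
    vanish. *)
Lemma blocks_joint s : (blocks_deg s <= K)%N ->
  phi (blocks_lim s) = Psi d (blocks_op s).
Proof.
have [k] := ubnP (size s); elim: k s => // k IHk s; rewrite ltnS => sk sK.
have [alt|/not_alternating[s1 [[b m1 x1 X1 Z1 S1] E]]] :=
    boolP (alternating s); last first.
  have {E} [[b' m2 x2 X2 Z2 S2] [s2 [sE /= bb']]] := E.
  case: b' / bb' S2 sE => S2 sE; rewrite {s}sE in sk sK *.
  pose s' := s1 ++ Block (joint_span_mul S1 S2) :: s2.
  have limE : blocks_lim (s1 ++ Block S1 :: Block S2 :: s2) = blocks_lim s'.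
    by rewrite /blocks_lim !big_cat !big_cons /= !mulrA.
  have opE : blocks_op (s1 ++ Block S1 :: Block S2 :: s2) = blocks_op s'.
    by apply/funext => f; rewrite /blocks_op !map_cat !op_prod_cat.
  have degE : blocks_deg (s1 ++ Block S1 :: Block S2 :: s2) = blocks_deg s'.
    by rewrite /blocks_deg !big_cat !big_cons /= !addnA.
  rewrite limE opE; apply: IHk; rewrite -?degE//.
  by move: sk; rewrite !size_cat /= !addnS.
(* [s1] holds the blocks already centred, [s2] those still to be treated. *)
suff centre s2 s1 : alternating (s1 ++ s2) -> (size (s1 ++ s2) <= k)%N ->
    (blocks_deg (s1 ++ s2) <= K)%N ->
    all (fun z => phi (block_lim z) == 0) s1 ->
    phi (blocks_lim (s1 ++ s2)) = Psi d (blocks_op (s1 ++ s2)).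
  exact: (centre s [::]).
clear s alt sk sK.
elim: s2 s1 => [|[b m x X Z S] s2 IH] s1; rewrite ?cats0 => alt sk sK c.
  case: (posnP (size s1)) => [/size0nil ->|s1_gt0].
    rewrite /blocks_lim big_nil phi1; have := phi_D [::].
    by rewrite big_nil phi1.
  rewrite phi_free_blocks// Psi_free//.
  move: sK c; rewrite /blocks_deg; elim: (s1) => //= z s IHs.
  rewrite big_cons => sK /andP[/eqP z0 c].
  (* Blocks are centred with respect to [phi]; since the marginals agree, they are centred for [Psi]
     too. *)
  rewrite -(phi_pure _ (block_span z)) ?z0 ?eqxx/= ?IHs//.
    exact: leq_trans (leq_addl _ _) sK.
  exact: leq_trans (leq_addr _ _) sK.
(* [z] is the centred block, and the original one is [z] plus the constant [- a = phi x]. *)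
pose a := - phi x.
pose z := Block (joint_span_lin a (joint_span1 (pure b) m) S).
have limE : blocks_lim (s1 ++ Block S :: s2) =
    - a *: blocks_lim (s1 ++ s2) + blocks_lim (rcons s1 z ++ s2).
  rewrite /blocks_lim cat_rcons !big_cat !big_cons /=.
  rewrite mulrDl mulrDr -scalerAl mul1r -scalerAr addrA scaleNr.
  by rewrite addNr add0r.
have opE : blocks_op (s1 ++ Block S :: s2) =
    - a *: blocks_op (s1 ++ s2) + blocks_op (rcons s1 z ++ s2).
  apply/funext => f.
  rewrite -[RHS]/(- a *: blocks_op (s1 ++ s2) f +
    blocks_op (rcons s1 z ++ s2) f).
  rewrite cat_rcons !blocks_op_cat.
  rewrite -[blocks_op (z :: s2) f]/(a *: blocks_op s2 f + X (blocks_op s2 f)).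
  by rewrite (blocks_op_linear s1) addrA scaleNr addNr add0r.
rewrite limE opE linearP Psi_lin; congr (_ * _ + _).
  (* Dropping a block may destroy alternation, so this term goes to the outer induction, which does
     not assume it; the term with [z] goes to the inner one. *)
  move: sk sK; rewrite /blocks_deg !size_cat /= addnS => sk sK.
  apply: IHk; rewrite ?size_cat//.
  by apply: leq_trans sK; rewrite /blocks_deg !big_cat big_cons leq_add2l leq_addl.
apply: IH.
- by move: alt; rewrite /alternating cat_rcons !map_cat.
- by move: sk; rewrite cat_rcons !size_cat.
- by move: sK; rewrite /blocks_deg cat_rcons !big_cat !big_cons.
- by rewrite all_rcons c andbT /= linearP phi1 mulr1 addNr.
Qed.

Lemma phi_Psi_span m x X Z : (m <= K)%N -> joint_span xpredT m x X Z ->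
  phi x = Psi d X.
Proof.
move=> mK; elim=> [w _ wm|a x1 X1 Z1 x2 X2 Z2 _ E1 _ E2]; last first.
  by rewrite linearP Psi_lin E1 E2.
have pl l : pure (is_Y l) l by rewrite /pure.
(* Every letter is a block of degree [0] or [1], so the total degree of a word is its number of
   letters [Y]. *)
pose B l := Block (@joint_span_letter (pure (is_Y l)) (is_Y l) l (pl l) (leqnn _)).
have := @blocks_joint (map B w).
rewrite /blocks_lim /blocks_op /blocks_deg !big_map -map_comp; apply.
rewrite (leq_trans _ (leq_trans wm mK))//.
by elim: (w) => [|l w' IH]; rewrite ?big_nil ?big_cons//= leq_add2l.
Qed.

End JointMoments.

(** * Linearity of the expectation on bounded random variables *)

Section BoundedVariables.
Variables (R : realType) (disp : measure_display) (T : measurableType disp).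
Variable P : probability T R.
Local Notation C := R[i].

(** This class is closed under sums and products and consists of integrable functions, so it
    contains all entries of matrix polynomials. Integrability matters because [fine] sends infinite
    expectations to [0], which would break additivity. *)
Definition bounded_rv (f : T -> R) : Prop :=
  measurable_fun setT f /\ exists B : R, {ae P, forall t, `|f t| <= B}.

Lemma bounded_rv_cst (c : R) : bounded_rv (fun=> c).
Proof. by split; [exact: measurable_cst|exists `|c|; apply: aeW]. Qed.

Lemma bounded_rvD f g : bounded_rv f -> bounded_rv g ->
  bounded_rv (fun t => f t + g t).
Proof.
move=> [mf [B fB]] [mg [B' gB]]; split; first exact: measurable_funD.
exists (B + B'); apply: filterS2 fB gB => t ft gt.
exact: le_trans (ler_normD _ _) (lerD ft gt).
Qed.

Lemma bounded_rvM f g : bounded_rv f -> bounded_rv g ->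
  bounded_rv (fun t => f t * g t).
Proof.
move=> [mf [B fB]] [mg [B' gB]]; split; first exact: measurable_funM.
by exists (B * B'); apply: filterS2 fB gB => t ft gt; rewrite normrM ler_pM.
Qed.

Lemma bounded_rv_Lfun f : bounded_rv f -> f \in Lfun P 1.
Proof.
move=> [mf [B fB]]; apply/Lfun1_integrable/integrableP; split.
  exact/measurable_EFinP.
apply: (@le_lt_trans _ _ (\int[P]_t (`|B|%:E))%E).
  apply: ae_ge0_le_integral => //.
  - by apply/measurable_EFinP; exact: measurableT_comp.
  - by apply: filterS fB => t ft _; rewrite lee_fin (le_trans ft)// ler_norm.
by rewrite integral_cst//= probability_setT mule1 ltry.
Qed.

Definition rexpectation (f : T -> R) : R := fine ('E_P[f])%E.

Lemma rexpectation_lin (a : R) f g : bounded_rv f -> bounded_rv g ->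
  rexpectation (fun t => a * f t + g t) = a * rexpectation f + rexpectation g.
Proof.
move=> bf bg; have lf := bounded_rv_Lfun bf; have lg := bounded_rv_Lfun bg.
have laf := bounded_rv_Lfun (bounded_rvM (bounded_rv_cst a) bf).
rewrite /rexpectation -[X in ('E_P[X])%E]/((fun t => a * f t) \+ g).
rewrite expectationD// fineD ?expectation_fin_num//; congr (_ + _).
rewrite (_ : (fun t => a * f t) = a \o* f); last first.
  by apply/funext => t; rewrite /= mulrC.
by rewrite expectationZl// fineM// expectation_fin_num.
Qed.

Definition bounded_crv (f : T -> C) : Prop :=
  bounded_rv (fun t => complex.Re (f t)) /\ bounded_rv (fun t => complex.Im (f t)).

Lemma bounded_crv_cst (c : C) : bounded_crv (fun=> c).
Proof. by split; exact: bounded_rv_cst. Qed.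

Lemma bounded_crvD f g : bounded_crv f -> bounded_crv g ->
  bounded_crv (fun t => f t + g t).
Proof.
move=> [rf jf] [rg jg]; split.
  rewrite (_ : (fun t => _) = fun t => complex.Re (f t) + complex.Re (g t)).
    exact: bounded_rvD.
  by apply/funext => t; case: (f t) (g t) => [? ?] [].
rewrite (_ : (fun t => _) = fun t => complex.Im (f t) + complex.Im (g t)).
  exact: bounded_rvD.
by apply/funext => t; case: (f t) (g t) => [? ?] [].
Qed.

Lemma bounded_crvM f g : bounded_crv f -> bounded_crv g ->
  bounded_crv (fun t => f t * g t).
Proof.
move=> [rf jf] [rg jg]; split.
  rewrite (_ : (fun t => _) = fun t => complex.Re (f t) * complex.Re (g t)
      + (-1) * (complex.Im (f t) * complex.Im (g t))).
    apply: bounded_rvD; first exact: bounded_rvM.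
    by apply: bounded_rvM; [exact: bounded_rv_cst|exact: bounded_rvM].
  by apply/funext => t; case: (f t) (g t) => [? ?] [? ?]; rewrite mulN1r.
rewrite (_ : (fun t => _) = fun t => complex.Re (f t) * complex.Im (g t)
    + complex.Im (f t) * complex.Re (g t)).
  by apply: bounded_rvD; exact: bounded_rvM.
by apply/funext => t; case: (f t) (g t) => [? ?] [].
Qed.

Lemma bounded_crv_sum (I : Type) (s : seq I) (F : I -> T -> C) :
  (forall i, bounded_crv (F i)) -> bounded_crv (fun t => \sum_(i <- s) F i t).
Proof.
move=> bF; elim: s => [|i s IH].
  by under eq_fun do rewrite big_nil; exact: bounded_crv_cst.
by under eq_fun do rewrite big_cons; exact: bounded_crvD.
Qed.

Lemma cexpectation_lin (a : C) f g : bounded_crv f -> bounded_crv g ->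
  cexpectation P (fun t => a * f t + g t) =
  a * cexpectation P f + cexpectation P g.
Proof.
move=> [rf jf] [rg jg]; case: a => a b.
rewrite /cexpectation -!/(rexpectation _).
have -> : (fun t => complex.Re ((a +i* b) * f t + g t)) =
    fun t => a * complex.Re (f t) + (- b * complex.Im (f t) + complex.Re (g t)).
  by apply/funext => t; case: (f t) (g t) => [? ?] [? ?] /=; rewrite mulNr addrA.
have -> : (fun t => complex.Im ((a +i* b) * f t + g t)) =
    fun t => a * complex.Im (f t) + (b * complex.Re (f t) + complex.Im (g t)).
  by apply/funext => t; case: (f t) (g t) => [? ?] [? ?] /=; rewrite addrA.
have bZ c h : bounded_rv h -> bounded_rv (fun t => c * h t).
  by move=> bh; apply: bounded_rvM => //; exact: bounded_rv_cst.
rewrite !rexpectation_lin//; try by apply: bounded_rvD => //; exact: bZ.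
by simpc; rewrite !addrA.
Qed.

Lemma cexpectation_cst (c : C) : cexpectation P (fun=> c) = c.
Proof. by rewrite /cexpectation !expectation_cst /=; case: c. Qed.

Lemma tau_lin n (a : C) (X Z : T -> 'M[C]_n) :
  (forall i j, bounded_crv (fun t => X t i j)) ->
  (forall i j, bounded_crv (fun t => Z t i j)) ->
  tau P (fun t => a *: X t + Z t) = a * tau P X + tau P Z.
Proof.
move=> bX bZ; rewrite /tau mulrCA -mulrDr; congr (_ * _).
rewrite mulr_sumr -big_split; apply: eq_bigr => j _ /=.
by rewrite -cexpectation_lin//; congr cexpectation; apply/funext => t; rewrite !mxE.
Qed.

End BoundedVariables.

(** * Matrix entries and the operator norm *)

Section OperatorNorm.
Variables (R : realType) (n : nat).
Local Notation C := R[i].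
Local Notation normc := (@ComplexField.Normc.normc R).

Lemma normc_ge0 (z : C) : 0 <= normc z.
Proof. by case: z => a b; exact: sqrtr_ge0. Qed.

Lemma normc_sum (I : Type) (s : seq I) (F : I -> C) :
  normc (\sum_(i <- s) F i) <= \sum_(i <- s) normc (F i).
Proof.
elim: s => [|i s IH]; first by rewrite !big_nil ComplexField.Normc.normc0.
rewrite !big_cons (le_trans (le_normcD _ _))// lerD2l//.
Qed.

Lemma normc_le_eucl_norm (v : 'cV[C]_n) i : normc (v i 0) <= eucl_norm v.
Proof.
rewrite -[leLHS]ger0_norm ?normc_ge0// -sqrtr_sqr ler_wsqrtr//.
by rewrite (bigD1 i)//= lerDl sumr_ge0// => k _; exact: sqr_ge0.
Qed.

Lemma entry_le_op_norm (A : 'M[C]_n) i j : normc (A i j) <= op_norm A.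
Proof.
have dj : eucl_norm (delta_mx j 0 : 'cV[C]_n) = 1.
  rewrite /eucl_norm (bigD1 j)//= big1 => [|k /negPf kj].
    by rewrite mxE !eqxx addr0 ComplexField.Normc.normc1 expr1n sqrtr1.
  by rewrite normc2_eq0// mxE kj.
have Aj : (A *m (delta_mx j 0 : 'cV[C]_n)) i 0 = A i j by rewrite -colE mxE.
rewrite -Aj (le_trans (normc_le_eucl_norm _ _))//; apply: ub_le_sup; last first.
  by exists (delta_mx j 0) => //=; rewrite dj.
(* The supremum dominates its members only if the set is bounded above; this bound comes from the
   coordinates of [v] having modulus at most [1]. *)
exists (Num.sqrt (\sum_i (\sum_j normc (A i j)) ^+ 2)) => _ [v /= v1 <-].
rewrite ler_wsqrtr// ler_sum// => k _.
rewrite lerXn2r ?nnegrE ?normc_ge0 ?sumr_ge0//; first by move=> *; exact: normc_ge0.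
rewrite mxE (le_trans (normc_sum _ _))// ler_sum// => l _.
rewrite ComplexField.Normc.normcM ler_piMr ?normc_ge0//.
exact: le_trans (normc_le_eucl_norm _ _) v1.
Qed.

End OperatorNorm.

(** * Limits of complex sequences *)

Section Convergence.
Variable R : realType.
Local Notation C := R[i].

Lemma converges_unique (x : nat -> C) l l' :
  converges x l -> converges x l' -> l = l'.
Proof. exact: (cvg_unique (@norm_hausdorff _ C^o)). Qed.

Lemma converges_lin (a : C) (x x' : nat -> C) l l' :
  converges x l -> converges x' l' ->
  converges (fun n => a * x n + x' n) (a * l + l').
Proof.
move=> xl xl'; apply: (@cvgD _ C^o) xl'.
exact: (@cvgMl_tmp _ _ _ _ (fun n => x n : C^o) a l).
Qed.

Lemma converges_near (x x' : nat -> C) l : (\forall n \near \oo, x n = x' n) ->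
  converges x l -> converges x' l.
Proof. by move=> xx'; apply: cvg_trans; exact: near_eq_cvg. Qed.

Lemma converges_real (x : nat -> R) (l : R) : x n @[n --> \oo] --> l ->
  converges (fun n => (x n)%:C) l%:C.
Proof.
move=> xl; apply/(@cvgrPdist_lt _ C^o) => eps eps0.
(* A positive element for the order on complex numbers is real. *)
have epsE : eps = (complex.Re eps)%:C.
  by case: eps eps0 => a b; rewrite ltcE /= => /andP[/eqP -> _].
have re0 : 0 < complex.Re eps by move: eps0; rewrite epsE ltcR.
move/cvgrPdist_lt : xl => /(_ _ re0); apply: filterS => n.
by rewrite epsE -rmorphB normc_def /= expr0n addr0 sqrtr_sqr ltcR.
Qed.

Lemma converges_sum (I : Type) (s : seq I) (a : I -> C) (x : I -> nat -> C)
    (l : I -> C) : (forall i, converges (x i) (l i)) ->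
  converges (fun n => \sum_(i <- s) a i * x i n) (\sum_(i <- s) a i * l i).
Proof.
move=> xl; elim: s => [|i s IH].
  rewrite big_nil; under eq_fun do rewrite big_nil; exact: cvg_cst.
rewrite big_cons; under eq_fun do rewrite big_cons; exact: converges_lin.
Qed.

End Convergence.

(** * Moments of the matrices [D_q] and of the projections [P_q] *)

Section DiagonalProjections.
Variables (R : realType) (disp : measure_display) (T : measurableType disp).
Variables (P : probability T R) (r : nat) (d : 'I_r -> R).
Local Notation C := R[i].

Lemma prod_diag_ind n (I : Type) (A : I -> {set 'I_n}) (s : seq I) :
  \prod_(i <- s) diag_ind R (A i) =
  diag_mx (\row_j \prod_(i <- s) (j \in A i)%:R).
Proof.
elim: s => [|i s IH].
  rewrite big_nil -[1]/(1%:M) -diag_const_mx; congr diag_mx.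
  by apply/rowP => j; rewrite !mxE big_nil.
rewrite big_cons IH -[_ * _]/(_ *m _) mulmx_diag; congr diag_mx.
by apply/rowP => j; rewrite !mxE big_cons.
Qed.

(** The sum over [p] handles words of all lengths alike, including the empty one, and matches
    [Psi_proj_word] term by term, with [n_p / n] in place of [d p]. *)
Lemma tau_prod_diag_ind n (N : 'I_r -> {set 'I_n}) (qs : seq 'I_r) :
  interval_partition N ->
  tau P (fun=> \prod_(q <- qs) diag_ind R (N q)) =
  \sum_p (\prod_(q <- qs) (p == q)%:R) * (#|N p|%:R / n%:R : R)%:C.
Proof.
move=> [_ Ndisj Ncover _]; rewrite /tau.
have E j : \prod_(q <- qs) (j \in N q)%:R =
    \sum_p (\prod_(q <- qs) (p == q)%:R) * (j \in N p)%:R :> C.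
  have [p jp] := Ncover j.
  rewrite [RHS](bigD1 p)//= jp mulr1 [X in _ + X]big1 ?addr0 => [|p' p'p].
    apply: eq_bigr => q _; congr (nat_of_bool _)%:R.
    by apply/idP/eqP => [/(Ndisj _ _ _ jp)//|<-].
  have [jp'|_] := boolP (j \in N p'); last by rewrite mulr0.
  by move: p'p; rewrite (Ndisj _ _ _ jp jp') eqxx.
have {}E j : cexpectation P (fun=> (\prod_(q <- qs) diag_ind R (N q)) j j) =
    \sum_p (\prod_(q <- qs) (p == q)%:R) * (j \in N p)%:R.
  by rewrite cexpectation_cst prod_diag_ind !mxE eqxx mulr1n E.
rewrite (eq_bigr _ (fun j _ => E j)).
rewrite exchange_big mulr_sumr; apply: eq_bigr => p _.
rewrite -mulr_sumr mulrCA -natr_sum; congr (_ * _).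
have -> : (\sum_j (j \in N p))%N = #|N p|.
  by rewrite -sum1_card [RHS]big_mkcond; apply: eq_bigr => j _; case: ifP.
by rewrite rmorphM fmorphV !rmorph_nat mulrC.
Qed.

Lemma Psi_proj_word (U : finType) (qs : seq 'I_r) :
  Psi d (op_prod [seq @Defs.proj R r U q | q <- qs]) =
  \sum_p (\prod_(q <- qs) (p == q)%:R) * (d p)%:C.
Proof.
rewrite (@Psi_diagonal _ _ _ _ _ (fun p => \prod_(q <- qs) (p == q)%:R)).
  by apply: eq_bigr => p _; rewrite mulrC.
move=> f w; elim: qs => [|q qs IH]; first by rewrite big_nil mul1r.
rewrite [LHS]projE IH big_cons; case: (start w == q); first by rewrite mul1r.
by rewrite !mul0r.
Qed.

End DiagonalProjections.

(** * Convergence for polynomials in the random matrices, and the symmetric blocks as such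
    polynomials *)

Section SpanConvergence.
Variables (R : realType) (r : nat) (U : finType).
Variables (d : 'I_r -> R) (kappa : U -> nat -> R).
Local Notation C := R[i].
Local Notation M := (l2 R (word r U)).
Variables (A : algType C) (phi : {scalar A}) (y : U -> A) (e : 'I_r -> A).
Variables (disp : measure_display) (T : measurableType disp).
Variables (P : probability T R) (K : nat).
Variables (Y : U -> forall n, T -> 'M[C]_n) (N : forall n, 'I_r -> {set 'I_n}).
Local Notation D := (fun q n => diag_ind R (N n q)).
Local Notation span := (joint_span d kappa y e K Y D).

Hypothesis Y_bounded : forall u n i j, bounded_crv P (fun t => Y u n t i j).
Hypothesis word_limit : forall w : seq (U + 'I_r),
  converges (fun n => tau P (fun t => \prod_(x <- w)
      match x with inl u => Y u n t | inr q => diag_ind R (N n q) end))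
    (phi (\prod_(x <- w) match x with inl u => y u | inr q => e q end)).

Lemma bounded_span Q m x X Z : span Q m x X Z ->
  forall n i j, bounded_crv P (fun t => Z n t i j).
Proof.
elim=> [w _ _|a x1 X1 Z1 x2 X2 Z2 _ IH1 _ IH2] n i j.
  elim: w i j => [|l w IH] i j.
    by under eq_fun do rewrite big_nil; exact: bounded_crv_cst.
  under eq_fun do rewrite big_cons mxE.
  apply: bounded_crv_sum => k; apply: bounded_crvM => //.
  by case: l => [u|q]; [exact: Y_bounded|exact: bounded_crv_cst].
under eq_fun do rewrite !mxE.
by apply: bounded_crvD => //; apply: bounded_crvM => //; exact: bounded_crv_cst.
Qed.

Lemma span_converges Q m x X Z : span Q m x X Z ->
  converges (fun n => tau P (Z n)) (phi x).
Proof.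
elim=> [w _ _|a x1 X1 Z1 x2 X2 Z2 S1 IH1 S2 IH2]; first exact: word_limit.
rewrite linearP; under eq_fun => n do
  rewrite (tau_lin a (bounded_span S1 (n:=n)) (bounded_span S2 (n:=n))).
exact: converges_lin.
Qed.

Lemma span_sym_block p q u : exists x, span xpredT 1 x
  (hat_gamma d kappa K p q u) (fun n t => sym_block (N n) p q (Y u n t)).
Proof.
have S p' q' : span xpredT 1 (e p' * y u * e q')
    (fun f => @Defs.proj R r U p' (gamma d kappa K u (@Defs.proj R r U q' f)))
    (fun n t => diag_ind R (N n p') *m Y u n t *m diag_ind R (N n q')).
  have SD q0 := @joint_span_letter _ _ _ d kappa _ y e K _ Y D xpredT 0
    (inr q0) isT isT.
  have SY := @joint_span_letter _ _ _ d kappa _ y e K _ Y D xpredT 1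
    (inl u) isT isT.
  exact: joint_span_mul (joint_span_mul (SD p') SY) (SD q').
have [<-|pq] := eqVneq p q.
  exists (e p * y u * e p); apply: eq_joint_span (S p p) _ _ _ => //.
    by move=> f; rewrite /hat_gamma eqxx.
  by move=> n t; rewrite /sym_block eqxx.
(* The coefficient [1] fits the shape of [joint_span_lin], the constructor that forms sums. *)
exists (1 *: (e p * y u * e q) + e q * y u * e p).
apply: eq_joint_span (joint_span_lin 1 (S p q) (S q p)) _ _ _ => //.
  move=> f; rewrite /hat_gamma (negPf pq); congr (_ + _); exact: scale1r.
by move=> n t; rewrite /sym_block (negPf pq) scale1r.
Qed.

Lemma span_sym_block_word (w : seq (('I_r * 'I_r) * U)) : exists x,
  span xpredT (size w) x
    (op_prod [seq hat_gamma d kappa K z.1.1 z.1.2 z.2 | z <- w])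
    (fun n t => \prod_(z <- w) sym_block (N n) z.1.1 z.1.2 (Y z.2 n t)).
Proof.
elim: w => [|z w [x S]].
  exists 1; apply: eq_joint_span (joint_span1 _ _ _ _ _ _ _ _ _) _ _ _ => // n t.
  by rewrite big_nil.
have [x' S'] := span_sym_block z.1.1 z.1.2 z.2.
exists (x' * x); apply: eq_joint_span (joint_span_mul S' S) _ _ _ => // n t.
by rewrite big_cons.
Qed.

End SpanConvergence.

(** * From the assumptions on the random matrices to the limit theorem *)

Lemma bounded_crv_entry (R : realType) (disp : measure_display)
    (T : measurableType disp) (P : probability T R) n (X : T -> 'M[R[i]]_n) C :
  (forall i j, in_all_Lp P (fun t => X t i j)) ->
  {ae P, forall t, op_norm (X t) <= C} ->
  forall i j, bounded_crv P (fun t => X t i j).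
Proof.
(* Membership in [L^1] supplies measurability, the norm bound supplies boundedness almost
   everywhere. *)
move=> XL XC i j; have [re im] := XL i j 1 (lexx _).
have XB t : op_norm (X t) <= C -> `|complex.Re (X t i j)| <= C /\
    `|complex.Im (X t i j)| <= C.
  move=> /(le_trans (entry_le_op_norm _ i j)); case: (X t i j) => a b /= abC.
  split; apply: le_trans abC; rewrite -sqrtr_sqr ler_wsqrtr//.
    by rewrite lerDl sqr_ge0.
  by rewrite lerDr sqr_ge0.
split; split.
- by move: re => /sub_Lfun_mfun; rewrite inE.
- by exists C; apply: filterS XC => t /XB[].
- by move: im => /sub_Lfun_mfun; rewrite inE.
- by exists C; apply: filterS XC => t /XB[].
Qed.

Theorem corollary6p1 (R : realType) (r : nat) (U : finType)
    (d : 'I_r -> R) (kappa : U -> nat -> R)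
    (N : forall n : nat, 'I_r -> {set 'I_n})
    (disp : measure_display) (T : measurableType disp) (P : probability T R)
    (Y : U -> forall n : nat, T -> 'M[R[i]]_n) (C : R)
    (r_gt0 : (0 < r)%N)
    (N_part : forall n : nat, (r <= n)%N -> interval_partition (N n))
    (N_lim : forall q : 'I_r,
      ((#|N n q|%:R / n%:R : R) @[n --> \oo] --> d q) /\ 0 <= d q)
    (Y_Lp : forall u n i j, in_all_Lp P (fun t => Y u n t i j))
    (Y_herm : forall u n, {ae P, forall t, Y u n t \is hermsymmx})
    (Y_indep : independent_sigma P
      (fun k : U * nat => sigma_entries (Y k.1 k.2)))
    (Y_lim : same_limit_moments P d kappa Y)
    (Y_free : asymptotically_free P Y (fun q n => diag_ind R (N n q)))
    (Y_bound : forall u n, {ae P, forall t, op_norm (Y u n t) <= C}) :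
  forall (w : seq (('I_r * 'I_r) * U)) (K : nat), (size w <= K)%N ->
    converges
      (fun n => tau P (fun t => \prod_(x <- w)
         sym_block (N n) x.1.1 x.1.2 (Y x.2 n t)))
      (Psi d (op_prod [seq hat_gamma d kappa K x.1.1 x.1.2 x.2 | x <- w])).
Proof.
move=> w K wK; have [A [phi [y [e [phi1 phi_free word_limit]]]]] := Y_free.
have bY u n i j : bounded_crv P (fun t => Y u n t i j).
  exact: bounded_crv_entry (Y_Lp u n) (Y_bound u n) i j.
have phi_D qs : phi (\prod_(q <- qs) e q) =
    Psi d (op_prod [seq @Defs.proj R r U q | q <- qs]).
  have := word_limit (map inr qs); rewrite big_map => h.
  apply: converges_unique h _; rewrite Psi_proj_word.
  (* The intervals form a partition once [n] is at least [r], so the exact formula for the moments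
     holds eventually. *)
  apply: (@converges_near _ (fun n =>
    \sum_p (\prod_(q <- qs) (p == q)%:R) * (#|N n p|%:R / n%:R : R)%:C)).
    exists r => // n /= rn; rewrite -(tau_prod_diag_ind P qs (N_part n rn)).
    by congr tau; apply/funext => t; rewrite big_map.
  by apply: converges_sum => p; apply: converges_real; case: (N_lim p).
have phi_Y us : (size us <= K)%N -> phi (\prod_(u <- us) y u) =
    Psi d (op_prod [seq gamma d kappa K u | u <- us]).
  (* [Y_lim] truncates at the length of the word; the common level [K] gives the same moment. *)
  move=> usK; rewrite -(Psi_gamma_trunc _ _ (leqnn _) usK).
  have := word_limit (map inl us); rewrite big_map => h.
  apply: converges_unique h _; apply: converges_near (Y_lim us).
  by near=> n; congr tau; apply/funext => t; rewrite big_map.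
have d_ge0 q : 0 <= d q by case: (N_lim q).
have d_sum1 : \sum_q d q = 1.
  (* The empty word in [phi_D] compares [phi 1 = 1] with the total weight. *)
  have := phi_D [::]; rewrite big_nil phi1 Psi_proj_word.
  under eq_bigr do rewrite big_nil mul1r.
  by rewrite -rmorph_sum => /(congr1 (@complex.Re R)) /esym.
(* The moments of the matrices tend to [phi x], which equals the moment of the operators under [Psi]
   because the degree [size w] is at most [K]. *)
have [x S] := span_sym_block_word d kappa y e K Y N w.
rewrite -(phi_Psi_span d_ge0 d_sum1 phi1 phi_free phi_Y phi_D wK S).
exact: (span_converges bY word_limit S).
Unshelve. all: by end_near.
Qed.
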